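(* For any finitary convergent processes $\Delta$ and $\Gamma$, if $\Delta\sqsubseteq_{FS}\Gamma$ then $\Delta\sqsubseteq_{\mathbf{rr}\mathrm{must}}\Gamma$.
   Context: Subdistributions over $S$: $\Delta:S\to[0,1]$, $\sum_s\Delta(s)\le1$, support $\lceil\Delta\rceil$, pointwise sums/scalar multiples, $\overline s$ point distribution, $\varepsilon$ zero subdistribution; $\mathrm{Exp}_\Delta(f)=\sum_s\Delta(s)f(s)$ componentwise; $f(\Delta)(t)=\sum_{f(s)=t}\Delta(s)$. A pLTS $\langle S,L,\to\rangle$ has $\to\subseteq S\times(L\cup\{\tau\})\times\mathcal D(S)$ ($\mathcal D(S)$ full distributions, $\tau\notin L$); deterministic: at most one $\Delta$ with $s\xrightarrow{\alpha}\Delta$ per $s,\alpha$; finitely branching: $\{\Delta\mid s\xrightarrow{\alpha}\Delta\}$ finite for each $s$; a subdistribution is finitary if the sub-pLTS of states reachable from it has finitely many states and is finitely branching. Processes are distributions over a fixed pLTS $\langle\mathbf P,\mathsf{Act},\to_{\mathbf P}\rangle$. A process $\Delta$ is convergent if there is no infinite sequence $\Lambda_0\xrightarrow{\tau}\Lambda_1\xrightarrow{\tau}\cdots$ (lifted transitions) with $\Lambda_0$ reachable from $\Delta$. $\Omega$ (countably infinite) is a set of success actions disjoint from $\mathsf{Act}\cup\{\tau\}$; $\Omega$-tests are distributions over a fixed pLTS $\langle\mathbf T,\mathsf{Act}\cup\Omega,\to_{\mathbf T}\rangle$ (assumed sufficiently expressive, e.g. interpreting all pCSP processes) whose states satisfy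 (A) $t\xrightarrow{\omega_1},t\xrightarrow{\omega_2}$ ($\omega_i\in\Omega$) imply $\omega_1=\omega_2$; (B) if $t\xrightarrow{\omega}$ and $t\xrightarrow{\alpha}\Delta$ ($\alpha\in\mathsf{Act}\cup\{\tau\}$) then $u\xrightarrow{\omega}$ for all $u\in\lceil\Delta\rceil$. $\Theta\|\Delta$ lives in the pLTS on $\{t\|p\}$ with labels $\Omega$ generated by: $t\xrightarrow{\alpha}_{\mathbf T}\Theta$, $\alpha\notin\mathsf{Act}$ gives $t\|p\xrightarrow{\alpha}\Theta\|\overline p$; $p\xrightarrow{\tau}_{\mathbf P}\Delta$ gives $t\|p\xrightarrow{\tau}\overline t\|\Delta$; $t\xrightarrow{a}\Theta,p\xrightarrow{a}\Delta$, $a\in\mathsf{Act}$ give $t\|p\xrightarrow{\tau}\Theta\|\Delta$; $(\Theta\|\Delta)(t\|p)=\Theta(t)\Delta(p)$. Resolutions of $\Theta\|\Delta$: $\langle R,\Lambda,\to_R\rangle$ with $\langle R,\Omega,\to_R\rangle$ deterministic, $\Lambda$ a subdistribution over $R$, and $f:R\to\mathbf C$ with $f(\Lambda)=\Theta\|\Delta$, $r\xrightarrow{\alpha}_R\Lambda''\Rightarrow f(r)\xrightarrow{\alpha}f(\Lambda'')$, $f(r)\xrightarrow{\alpha}\Rightarrow r\xrightarrow{\alpha}_R$. $\mathbb V$ is the least fixed point of $\mathcal R(f)(r)(\omega)=1$ if $r\xrightarrow{\omega}$; $0$ if $r\not\xrightarrow{\omega},r\not\xrightarrow{\tau}$; $\mathrm{Exp}_{\Delta}(f)(\omega)$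 if $r\not\xrightarrow{\omega}$, $r\xrightarrow{\tau}\Delta$. $\mathcal A(\Theta,\Delta)=\{\mathrm{Exp}_\Lambda(\mathbb V)\mid\text{resolutions of }\Theta\|\Delta\}$. $\Delta\sqsubseteq_{\mathbf{rr}\mathrm{must}}\Gamma$ iff for all $\Omega$-tests $\Theta$ and $h\in[-1,1]^\Omega$, $\inf h\cdot\mathcal A(\Theta,\Delta)\le\inf h\cdot\mathcal A(\Theta,\Gamma)$, where $h\cdot o=\sum_\omega h(\omega)o(\omega)$. Lifting of $\mathcal R\subseteq S\times\mathcal D_{sub}(S)$: smallest relation on subdistributions with $\overline s\,\overline{\mathcal R}\,\Delta$ when $s\mathcal R\Delta$, closed under $(\sum_ip_i\Gamma_i)\overline{\mathcal R}(\sum_ip_i\Delta_i)$ for $\Gamma_i\overline{\mathcal R}\Delta_i$, $p_i\in[0,1]$, $\sum_ip_i\le1$, $I$ arbitrary. $\Delta\Rightarrow\Delta'$ iff there are $\Delta_k^\to,\Delta_k^\times$ with $\Delta=\Delta_0^\to+\Delta_0^\times$, $\Delta_k^\to\xrightarrow{\tau}\Delta_{k+1}^\to+\Delta_{k+1}^\times$, $\Delta'=\sum_k\Delta_k^\times$. $\Delta\overset{a}{\Rightarrow}\Delta'$ iff $\Delta\Rightarrow\Delta^{pre}\xrightarrow{a}\Delta^{post}\Rightarrow\Delta'$; $\overset{\tau}{\Rightarrow}$ is $\Rightarrow$. For $A\subseteq\mathsf{Act}$: $s\not\xrightarrow{A}$ iff $s\not\xrightarrow{\alpha}$ for all $\alpha\in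 A\cup\{\tau\}$; $\Delta\not\xrightarrow{A}$ iff this holds for all $s\in\lceil\Delta\rceil$; $\Delta\overset{A}{\not\Rightarrow}$ iff $\Delta\Rightarrow\Delta^{pre}$ with $\Delta^{pre}\not\xrightarrow{A}$. $\lhd_{FS}$ is the largest relation in $\mathbf P\times\mathcal D_{sub}(\mathbf P)$ such that $s\lhd_{FS}\Delta$ implies: (i) if $\overline s\overset{\alpha}{\Rightarrow}\Gamma'$ ($\alpha\in\mathsf{Act}\cup\{\tau\}$) then $\Delta\overset{\alpha}{\Rightarrow}\Delta'$ for some $\Delta'$ with $\Gamma'\,\overline{\lhd_{FS}}\,\Delta'$; (ii) if $\overline s\overset{A}{\not\Rightarrow}$ then $\Delta\overset{A}{\not\Rightarrow}$. $\Delta\sqsubseteq_{FS}\Gamma$ iff $\Delta\Rightarrow\Delta^\natural$ for some $\Delta^\natural$ with $\Gamma\,\overline{\lhd_{FS}}\,\Delta^\natural$. *)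

(* Defs.v *)
From HB Require Import structures.
From mathcomp Require Import all_boot all_order all_algebra.
From mathcomp Require Import all_classical all_reals all_analysis.

Set Implicit Arguments.
Unset Strict Implicit.
Unset Printing Implicit Defensive.

Import Order.TTheory GRing.Theory Num.Theory.

Local Open Scope classical_set_scope.
Local Open Scope ring_scope.

Section Esum.
Context {R : realType}.
Local Open Scope ereal_scope.

Lemma le_esumZl (I : choiceType) (r : R) (f : I -> \bar R) :
  (0 <= r)%R -> (forall i, 0 <= f i) ->
  \esum_(i in setT) (r%:E * f i) <= r%:E * \esum_(i in setT) f i.
Proof.
move=> r0 f0; apply: ge_ereal_sup => _ [X [finX XI]] <-.
rewrite -ge0_mule_fsumr//; apply: lee_wpmul2l; first by rewrite lee_fin.
by apply: esum_ge; exists X.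
Qed.

Lemma ge0_esumZl (I : choiceType) (r : R) (f : I -> \bar R) :
  (0 <= r)%R -> (forall i, 0 <= f i) ->
  \esum_(i in setT) (r%:E * f i) = r%:E * \esum_(i in setT) f i.
Proof.
move=> r0 f0; apply/eqP; rewrite eq_le le_esumZl//=.
have [->|rN0] := eqVneq r 0%R.
  by rewrite mul0e; apply: esum_ge0 => i _; rewrite mul0e.
have rV0 : (0 <= r^-1)%R by rewrite invr_ge0.
have rf0 i : 0 <= r%:E * f i by rewrite mule_ge0// lee_fin.
have := le_esumZl rV0 rf0.
under eq_esum do rewrite muleA -EFinM mulVf// mul1e.
move=> /(lee_wpmul2l (_ : 0 <= r%:E)); rewrite lee_fin r0 => /(_ isT).
by rewrite muleA -EFinM divff// mul1e.
Qed.

End Esum.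

(** ** Subdistributions *)

(* Sums over an arbitrary index set are unordered sums of nonnegative terms;
   in particular the support of a subdistribution is countable. *)
Record subdist (R : realType) (S : choiceType) := SubDist {
  sd :> S -> R ;
  sd_ge0 : forall s, 0 <= sd s ;
  sd_le1 : (\esum_(s in [set: S]) (sd s)%:E <= 1)%E }.

Definition full (R : realType) (S : choiceType) (D : subdist R S) : Prop :=
  (\esum_(s in [set: S]) (D s)%:E = 1)%E.

Definition support (R : realType) (S : choiceType) (D : subdist R S) : set S :=
  [set s | D s != 0].

Section Constructions.
Context {R : realType}.
Implicit Types S U I : choiceType.

Section OfEreal.
Local Open Scope ereal_scope.
Variables (S : choiceType) (g : S -> \bar R).
Hypotheses (g0 : forall s, 0 <= g s) (g1 : \esum_(s in [set: S]) g s <= 1).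

Lemma of_ereal_finE s : (fine (g s))%:E = g s.
Proof.
rewrite fineK// ge0_fin_numE//; apply: (@le_lt_trans _ _ 1); last exact: ltry.
apply: le_trans g1; rewrite -(@esum_set1 R S s g)//.
rewrite esum_mkcond; apply: le_esum => i _.
by case: ifP => // _; exact: g0.
Qed.

Lemma of_ereal_ge0 s : (0 <= fine (g s))%R.
Proof. exact: fine_ge0. Qed.

Lemma of_ereal_le1 : \esum_(s in [set: S]) (fine (g s))%:E <= 1.
Proof. by under eq_esum do rewrite of_ereal_finE. Qed.

Definition of_ereal : subdist R S := SubDist of_ereal_ge0 of_ereal_le1.

End OfEreal.

Section Point.
Variables (S : choiceType) (s : S).

Lemma point_ge0 t : 0 <= ((t == s)%:R : R).
Proof. exact: ler0n. Qed.

Lemma point_sum : (\esum_(t in [set: S]) ((t == s)%:R : R)%:E = 1)%E.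
Proof.
rewrite -[RHS](@esum_set1 R S s (fun=> 1%E))// [RHS]esum_mkcond.
by apply: eq_esum => t _; case: eqP => [->|ts]; [rewrite mem_set | rewrite memNset].
Qed.

Lemma point_le1 : (\esum_(t in [set: S]) ((t == s)%:R : R)%:E <= 1)%E.
Proof. by rewrite point_sum. Qed.

Definition dpoint : subdist R S := SubDist point_ge0 point_le1.

Lemma dpoint_full : full dpoint.
Proof. exact: point_sum. Qed.

End Point.

Section Push.
Local Open Scope ereal_scope.
Variables (S U : choiceType) (f : S -> U) (D : subdist R S).

Let g (u : U) : \bar R := \esum_(s in f @^-1` [set u]) (D s)%:E.

Lemma push_ge0 u : 0 <= g u.
Proof. by apply: esum_ge0 => s _; rewrite lee_fin sd_ge0. Qed.

Lemma push_sum :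
  \esum_(u in [set: U]) g u = \esum_(s in [set: S]) (D s)%:E.
Proof.
have D0 s : 0 <= (D s)%:E by rewrite lee_fin sd_ge0.
rewrite /g (esum_esum (a := fun _ s => (D s)%:E))//; symmetry.
rewrite (reindex_esum ([set: U] `*`` (fun u => f @^-1` [set u])) _ snd)//; split => //=.
  by move=> [u s] [u' s']; rewrite !inE/= => -[_ <-] [_ <-] ->.
by move=> s _; exists (f s, s).
Qed.

Lemma push_le1 : \esum_(u in [set: U]) g u <= 1.
Proof. by rewrite push_sum sd_le1. Qed.

Definition dpush : subdist R U := of_ereal push_ge0 push_le1.

End Push.

Section Mix.
Local Open Scope ereal_scope.
Variables (S I : choiceType) (p : subdist R I) (F : I -> subdist R S).

Let g (s : S) : \bar R := \esum_(i in [set: I]) (p i * F i s)%:E.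

Lemma mix_ge0 s : 0 <= g s.
Proof. by apply: esum_ge0 => i _; rewrite lee_fin mulr_ge0// sd_ge0. Qed.

Lemma mix_le1 : \esum_(s in [set: S]) g s <= 1.
Proof.
have pF0 i s : 0 <= (p i * F i s)%:E by rewrite lee_fin mulr_ge0// sd_ge0.
rewrite /g esum_esum//.
rewrite (reindex_esum ([set: I] `*`` (fun=> [set: S])) _
  (fun x => (x.2, x.1))); last first.
  split => //=.
    by move=> [i s] [i' s'] _ _ [-> ->].
  by move=> [s i] _; exists (i, s).
rewrite -(@esum_esum R I S setT (fun=> setT) (fun i s => (p i * F i s)%:E))//.
apply: le_trans (sd_le1 p); apply: le_esum => i _.
under eq_esum do rewrite EFinM.
rewrite ge0_esumZl ?sd_ge0//; last by move=> s; rewrite lee_fin sd_ge0.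
rewrite -[leRHS]mule1; apply: lee_wpmul2l; first by rewrite lee_fin sd_ge0.
exact: sd_le1.
Qed.

(* [dmix p F] is the pointwise sum of the [p i *: F i]; the weights form a
   subdistribution over the (arbitrary) index set. *)
Definition dmix : subdist R S := of_ereal mix_ge0 mix_le1.

End Mix.

Section Prod.
Local Open Scope ereal_scope.
Variables (S U : choiceType) (A : subdist R S) (B : subdist R U).

Lemma prod_ge0 (x : S * U) : (0 <= A x.1 * B x.2)%R.
Proof. by rewrite mulr_ge0// sd_ge0. Qed.

Lemma prod_sum : \esum_(x in [set: S * U]) (A x.1 * B x.2)%:E =
  \esum_(s in [set: S])
    ((A s)%:E * \esum_(u in [set: U]) (B u)%:E).
Proof.
transitivity (\esum_(s in [set: S]) \esum_(u in [set: U]) (A s * B u)%:E).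
  rewrite (@esum_esum R S U setT (fun=> setT) (fun s u => (A s * B u)%:E)).
    by congr esum; apply/seteqP; split.
  by move=> s u _ _; rewrite lee_fin mulr_ge0// sd_ge0.
apply: eq_esum => s _; rewrite -ge0_esumZl ?sd_ge0//.
by move=> u; rewrite lee_fin sd_ge0.
Qed.

Lemma prod_le1 : \esum_(x in [set: S * U]) (A x.1 * B x.2)%:E <= 1.
Proof.
rewrite prod_sum; apply: le_trans (sd_le1 A); apply: le_esum => s _.
rewrite -[leRHS]mule1; apply: lee_wpmul2l; first by rewrite lee_fin sd_ge0.
exact: sd_le1.
Qed.

Definition dprod : subdist R (S * U)%type := SubDist prod_ge0 prod_le1.

Lemma dprod_full : full A -> full B -> full dprod.
Proof.
move=> fA fB; rewrite /full [LHS]prod_sum fB.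
by under eq_esum do rewrite mule1.
Qed.

End Prod.

(* Only meant for nonnegative [f]. *)
Definition expect S (D : subdist R S) (f : S -> R) : R :=
  fine (\esum_(s in [set: S]) (D s * f s)%:E)%E.

End Constructions.

(** ** Probabilistic labelled transition systems *)

(* [None] is the internal action tau. *)
Record plts (R : realType) (S : choiceType) (L : Type) := PLTS {
  trans : S -> option L -> subdist R S -> Prop ;
  trans_full : forall s a D, trans s a D -> full D }.

Section PLTS.
Context {R : realType} {S : choiceType} {L : Type}.
Variable Q : plts R S L.
Implicit Types (s u : S) (D G : subdist R S) (a : option L).

Definition enables s a : Prop := exists D, trans Q s a D.

Definition deterministic : Prop :=
  forall s a D D', trans Q s a D -> trans Q s a D' -> D = D'.

Inductive reachable D : S -> Prop :=
| reachable_base s : support D s -> reachable D s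
| reachable_step s a E u :
    reachable D s -> trans Q s a E -> support E u -> reachable D u.

Definition finitary D : Prop :=
  finite_set [set s | reachable D s] /\
  forall s, reachable D s -> finite_set [set E | exists a, trans Q s a E].

Inductive lift (X : S -> subdist R S -> Prop) :
    subdist R S -> subdist R S -> Prop :=
| lift_point s D : X s D -> lift X (dpoint s) D
| lift_mix (I : choiceType) (p : subdist R I) (G D : I -> subdist R S) :
    (forall i, lift X (G i) (D i)) -> lift X (dmix p G) (dmix p D).

Definition ltrans a : subdist R S -> subdist R S -> Prop :=
  lift (fun s D => trans Q s a D).

(* A distribution is reachable from [D] when its support consists of states
   reachable from [D], so that divergence of only a part of [D] counts. The
   members of the sequence have full mass: the zero subdistribution can
   perform every lifted transition to itself. *)
Definition convergent D : Prop :=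
  ~ exists E : nat -> subdist R S,
      [/\ forall n, full (E n),
          forall s, support (E 0%N) s -> reachable D s &
          forall n, ltrans None (E n) (E n.+1)].

Definition wtau D D' : Prop :=
  exists Dto Dx : nat -> subdist R S,
    [/\ forall s, D s = Dto 0%N s + Dx 0%N s,
        forall k, exists2 E, ltrans None (Dto k) E &
          forall s, E s = Dto k.+1 s + Dx k.+1 s &
        forall s, (D' s)%:E = (\esum_(k in [set: nat]) (Dx k s)%:E)%E].

Definition weak a D D' : Prop :=
  if a is Some _ then
    exists Dpre Dpost, [/\ wtau D Dpre, ltrans a Dpre Dpost & wtau Dpost D']
  else wtau D D'.

Definition refuses (A : set L) s : Prop :=
  ~ enables s None /\ forall b : L, A b -> ~ enables s (Some b).

Definition drefuses (A : set L) D : Prop :=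
  forall s, support D s -> refuses A s.

Definition wrefuses (A : set L) D : Prop :=
  exists2 Dpre, wtau D Dpre & drefuses A Dpre.

Definition failure_simulation (X : S -> subdist R S -> Prop) : Prop :=
  forall s D, X s D ->
    (forall a G', weak a (dpoint s) G' ->
       exists2 D', weak a D D' & lift X G' D') /\
    (forall A, wrefuses A (dpoint s) -> wrefuses A D).

(* [lift] is monotone, so the union of all failure simulations is the
   largest one. *)
Definition fsim s D : Prop := exists2 X, failure_simulation X & X s D.

Definition fs_le D G : Prop := exists2 Dn, wtau D Dn & lift fsim G Dn.

End PLTS.

(** ** Testing *)

Section Test.
Context {R : realType} {Act : Type} {Omega : choiceType}.

Section Parallel.
Context {T P : choiceType}.
Variables (TT : plts R T (Act + Omega)) (PP : plts R P Act).

Definition test_conditions : Prop :=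
  (forall t w1 w2, enables TT t (Some (inr w1)) ->
     enables TT t (Some (inr w2)) -> w1 = w2) /\
  (forall t w (a : option Act) D, enables TT t (Some (inr w)) ->
     trans TT t (omap inl a) D ->
     forall u, support D u -> enables TT u (Some (inr w))).

Inductive par_trans :
    T * P -> option Omega -> subdist R (T * P)%type -> Prop :=
| par_success t p w Th : trans TT t (Some (inr w)) Th ->
    par_trans (t, p) (Some w) (dprod Th (dpoint p))
| par_test t p Th : trans TT t None Th ->
    par_trans (t, p) None (dprod Th (dpoint p))
| par_proc t p D : trans PP p None D ->
    par_trans (t, p) None (dprod (dpoint t) D)
| par_sync t p a Th D :
    trans TT t (Some (inl a)) Th -> trans PP p (Some a) D ->
    par_trans (t, p) None (dprod Th D).

Lemma par_trans_full x w D : par_trans x w D -> full D.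
Proof.
by case=> *; apply: dprod_full;
  first [exact: dpoint_full | apply: trans_full; eassumption].
Qed.

Definition par : plts R (T * P)%type Omega := PLTS par_trans_full.

End Parallel.

Definition resolution (C Q : choiceType) (CC : plts R C Omega)
    (D : subdist R C) (QQ : plts R Q Omega) (Lam : subdist R Q)
    (f : Q -> C) : Prop :=
  [/\ deterministic QQ,
      dpush f Lam = D,
      forall r a E, trans QQ r a E -> trans CC (f r) a (dpush f E) &
      forall r a, enables CC (f r) a -> enables QQ r a].

Section Value.
Variables (Q : choiceType) (QQ : plts R Q Omega).

(* For deterministic [QQ] the choice of the tau-successor is immaterial. *)
Definition value_step (g : Q -> Omega -> R) (r : Q) (w : Omega) : R :=
  if `[< enables QQ r (Some w) >] then 1
  else if pselect (enables QQ r None) is left h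
       then expect (projT1 (cid h)) (g ^~ w)
       else 0.

Definition value_fixpoint (g : Q -> Omega -> R) : Prop :=
  (forall r w, 0 <= g r w <= 1) /\ value_step g = g.

Definition value (V : Q -> Omega -> R) : Prop :=
  value_fixpoint V /\
  forall g, value_fixpoint g -> forall r w, V r w <= g r w.

End Value.

Definition outcomes (C : choiceType) (CC : plts R C Omega) (D : subdist R C) :
    set (Omega -> R) :=
  [set o | exists (Q : choiceType) (QQ : plts R Q Omega) (Lam : subdist R Q)
      (f : Q -> C) (V : Q -> Omega -> R),
    [/\ resolution CC D QQ Lam f, value QQ V &
        o = fun w => expect Lam (V ^~ w)]].

(* The sum of a signed family: positive part minus negative part. *)
Definition reward (h o : Omega -> R) : \bar R :=
  (\esum_(w in [set: Omega]) (Num.max (h w * o w) 0)%:E -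
   \esum_(w in [set: Omega]) (Num.max (- (h w * o w)) 0)%:E)%E.

Definition rrmust_le (T P : choiceType) (TT : plts R T (Act + Omega))
    (PP : plts R P Act) (D G : subdist R P) : Prop :=
  forall (Th : subdist R T) (h : Omega -> R),
    full Th -> (forall w, -1 <= h w <= 1) ->
    (ereal_inf [set reward h o | o in outcomes (par TT PP) (dprod Th D)] <=
     ereal_inf [set reward h o | o in outcomes (par TT PP) (dprod Th G)])%E.

End Test.

(* Main.v *)
(* Every outcome of Theta || Gamma is an outcome of Theta || Delta, so the infima
   compare whatever the rewards are.

   Fix a resolution of Theta || Gamma. At a resolution state r over t || p, the
   state p is failure-simulated by some full distribution E of states reachable
   from Delta, and a resolution of t || E is played as follows. The internal
   process moves that r makes before the next move of the test form one weak
   derivation from p, answered by one weak derivation from E. Then a move of the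
   test alone is copied, a synchronisation is answered by a weak a-move, and a
   deadlock by a weak derivation to a refusing distribution. After each answer
   the current state of Delta is paired at random with a new state of the given
   resolution, by conditioning a coupling that witnesses the lifted simulation;
   these random choices are silent moves of the play, contracted at the end.
   Averaged over E, the value of the play equals the value of r: each bound is an
   induction on the iterates whose supremum is the least fixed point.

   The averages lose nothing because a weak derivation of Delta keeps the total
   mass: by finiteness and convergence some bounded function grows by at least
   one, in expectation, along every internal step. *)
Require Import Defs.
From mathcomp Require Import all_boot all_order all_algebra finmap lra.
From mathcomp Require Import all_classical all_reals all_analysis.

Set Implicit Arguments.
Unset Strict Implicit.
Unset Printing Implicit Defensive.

Import Order.TTheory GRing.Theory Num.Theory Defs.

Local Open Scope classical_set_scope.
Local Open Scope ring_scope.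

(** * Expectations *)

Section Calculus.
Context {R : realType}.
Implicit Types S U I : choiceType.
Local Open Scope ereal_scope.

(* The absolute value only makes nonnegativity unconditional; [Ex] is used
   for nonnegative functions. *)
Definition Ex S (D : subdist R S) (f : S -> \bar R) : \bar R :=
  \esum_(s in [set: S]) ((D s)%:E * `|f s|).

Lemma sd_eqP S (D E : subdist R S) : (forall s, D s = E s) -> D = E.
Proof.
case: D E => [d d0 d1] [e e0 e1] /= /funext de; subst e.
by congr SubDist; exact: Prop_irrelevance.
Qed.

Lemma Ex_ge0 S (D : subdist R S) f : 0 <= Ex D f.
Proof. by apply: esum_ge0 => s _; rewrite mule_ge0// lee_fin sd_ge0. Qed.
Hint Resolve Ex_ge0 : core.

Lemma le_Ex S (D : subdist R S) f g : (forall s, 0 <= f s) ->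
  (forall s, D s != 0%R -> f s <= g s) -> Ex D f <= Ex D g.
Proof.
move=> f0 fg; apply: le_esum => s _.
have [->|Ds] := eqVneq (D s) 0%R; first by rewrite !mul0e.
apply: lee_wpmul2l; first by rewrite lee_fin sd_ge0.
by rewrite !gee0_abs ?fg// (le_trans (f0 s))// fg.
Qed.

Lemma eq_Ex S (D : subdist R S) f g :
  (forall s, D s != 0%R -> f s = g s) -> Ex D f = Ex D g.
Proof.
move=> fg; apply: eq_esum => s _.
by have [->|Ds] := eqVneq (D s) 0%R; [rewrite !mul0e|rewrite fg].
Qed.

Lemma Ex_point S (s : S) f : 0 <= f s -> Ex (dpoint s) f = f s.
Proof.
move=> f0; rewrite -[RHS](@esum_set1 R S s f)// [RHS]esum_mkcond.
apply: eq_esum => t _ /=; case: eqP => [->|ts].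
  by rewrite mul1e gee0_abs// mem_set.
by rewrite mul0e memNset.
Qed.

(** The constant may be infinite here, which pushing forward an extended real function requires. *)
Lemma ge0_esumZr I (A : set I) (a : I -> R) (c : \bar R) : (forall i, 0 <= a i)%R ->
  0 <= c -> \esum_(i in A) ((a i)%:E * c) = (\esum_(i in A) (a i)%:E) * c.
Proof.
move=> a0 c0; rewrite esum_mkcond [X in X * _]esum_mkcond.
pose b i := (if i \in A then a i else 0)%R.
have b0 i : (0 <= b i)%R by rewrite /b; case: ifP.
transitivity (\esum_(i in [set: I]) ((b i)%:E * c)).
  by apply: eq_esum => i _; rewrite /b; case: ifP => //; rewrite mul0e.
transitivity ((\esum_(i in [set: I]) (b i)%:E) * c); last first.
  by congr (_ * _); apply: eq_esum => i _; rewrite /b; case: ifP.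
case: c c0 => [r r0| _|//].
  rewrite muleC -ge0_esumZl//.
  by apply: eq_esum => i _; rewrite muleC.
(* The constant is infinite: both sides vanish if all weights do, and both are infinite as soon as
   one weight is positive. *)
have [Z|/existsNP[i /eqP bi]] := pselect (forall i, b i = 0%R).
  by rewrite !esum1 ?mul0e// => i _; rewrite Z// mul0e.
have bi0 : (0 < b i)%R by rewrite lt_neqAle b0 eq_sym andbT.
rewrite gt0_muley; last first.
  apply: (@lt_le_trans _ _ (b i)%:E); first by rewrite lte_fin.
  by apply: esum_ge; exists [set i]; [split|rewrite fsbig_set1].
apply/eqP; rewrite -leye_eq; apply: esum_ge; exists [set i]; first by split.
by rewrite fsbig_set1 gt0_muley ?lte_fin.
Qed.

Lemma esum_exchange S I (a : S -> I -> \bar R) : (forall s i, 0 <= a s i) ->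
  \esum_(s in [set: S]) \esum_(i in [set: I]) a s i =
  \esum_(i in [set: I]) \esum_(s in [set: S]) a s i.
Proof.
move=> a0; rewrite !esum_esum//.
rewrite (reindex_esum ([set: I] `*`` (fun=> [set: S])) _ (fun x => (x.2, x.1)))//.
by split => //= [[i s] [i' s'] _ _ [-> ->]//|[s i] _]; exists (i, s).
Qed.

Lemma Ex_push S U (g : S -> U) (D : subdist R S) f :
  Ex (dpush g D) f = Ex D (f \o g).
Proof.
rewrite /Ex.
transitivity (\esum_(u in [set: U]) \esum_(s in g @^-1` [set u])
    ((D s)%:E * `|f (g s)|)).
  apply: eq_esum => u _.
  rewrite [X in X * _ = _](of_ereal_finE (push_ge0 g D) (push_le1 g D)).
  rewrite -ge0_esumZr//; last by move=> s; exact: sd_ge0.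
  by apply: eq_esum => s ->.
rewrite (esum_esum (a := fun _ s => (D s)%:E * `|f (g s)|))//; last first.
  by move=> *; rewrite mule_ge0// lee_fin sd_ge0.
symmetry.
rewrite (reindex_esum ([set: U] `*`` (fun u => g @^-1` [set u])) _ snd)//; split => //=.
  by move=> [u s] [u' s']; rewrite !inE/= => -[_ <-] [_ <-] ->.
by move=> s _; exists (g s, s).
Qed.

Lemma Ex_exchange S U (D : subdist R S) (E : subdist R U) f :
  Ex D (fun s => Ex E (f s)) = Ex E (fun u => Ex D (f ^~ u)).
Proof.
have inner S' U' (A : subdist R S') (B : subdist R U') h s :
    (A s)%:E * `|Ex B (h s)| = \esum_(u in [set: U']) ((A s)%:E * ((B u)%:E * `|h s u|)).
  rewrite gee0_abs// ge0_esumZl ?sd_ge0// => u.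
  by rewrite mule_ge0// lee_fin sd_ge0.
rewrite /Ex; under eq_esum do rewrite inner.
under [RHS]eq_esum do rewrite (inner _ _ _ _ (fun u s => f s u)).
rewrite esum_exchange; last by move=> *; rewrite !mule_ge0// lee_fin sd_ge0.
by apply: eq_esum => u _; apply: eq_esum => s _; rewrite muleCA.
Qed.

Lemma Ex_mix S I (p : subdist R I) (F : I -> subdist R S) f :
  Ex (dmix p F) f = Ex p (fun i => Ex (F i) f).
Proof.
have pF0 i s : 0 <= (p i * F i s)%:E by rewrite lee_fin mulr_ge0// sd_ge0.
transitivity (\esum_(s in [set: S]) \esum_(i in [set: I])
    ((p i)%:E * ((F i s)%:E * `|f s|))).
  apply: eq_esum => s _.
  rewrite [X in X * _ = _](of_ereal_finE (mix_ge0 p F) (mix_le1 p F)).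
  rewrite -ge0_esumZr//; last by move=> i; rewrite mulr_ge0 ?sd_ge0.
  by apply: eq_esum => i _; rewrite EFinM muleA.
rewrite esum_exchange; last by move=> *; rewrite !mule_ge0// lee_fin sd_ge0.
apply: eq_esum => i _; rewrite gee0_abs// ge0_esumZl ?sd_ge0// => s.
by rewrite mule_ge0// lee_fin sd_ge0.
Qed.

Lemma Ex_prod S U (A : subdist R S) (B : subdist R U) f :
  Ex (dprod A B) f = Ex A (fun s => Ex B (fun u => f (s, u))).
Proof.
transitivity (\esum_(k in [set: S] `*`` (fun=> [set: U]))
      ((A k.1)%:E * ((B k.2)%:E * `|f (k.1, k.2)|))).
  rewrite (_ : _ `*`` _ = setT); last by apply/seteqP.
  by apply: eq_esum => -[s u] _ /=; rewrite EFinM muleA.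
rewrite -(@esum_esum _ _ _ setT (fun=> setT)
    (fun s u => (A s)%:E * ((B u)%:E * `|f (s, u)|)))//; last first.
  by move=> *; rewrite !mule_ge0// lee_fin sd_ge0.
apply: eq_esum => s _; rewrite gee0_abs// ge0_esumZl ?sd_ge0// => u.
by rewrite mule_ge0// lee_fin sd_ge0.
Qed.

Lemma Ex_ind S (D : subdist R S) s :
  Ex D (fun t => ((t == s)%:R : R)%:E) = (D s)%:E.
Proof.
rewrite -(@esum_set1 R S s (fun t => (D t)%:E)) ?lee_fin ?sd_ge0//.
rewrite [RHS]esum_mkcond; apply: eq_esum => t _.
rewrite gee0_abs ?lee_fin ?ler0n//; case: eqP => [->|ts].
  by rewrite mule1 mem_set.
by rewrite mule0 memNset.
Qed.

Lemma sd_eqEx S (D E : subdist R S) :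
  (forall f, (forall s, 0 <= f s) -> Ex D f = Ex E f) -> D = E.
Proof.
move=> DE; apply: sd_eqP => s; apply: EFin_inj; rewrite -!Ex_ind.
by apply: DE => t; rewrite lee_fin ler0n.
Qed.

Lemma Ex_add S (D : subdist R S) f g :
  (forall s, 0 <= f s) -> (forall s, 0 <= g s) ->
  Ex D (fun s => f s + g s) = Ex D f + Ex D g.
Proof.
move=> f0 g0; rewrite -esumD; last 2 first.
- by move=> *; rewrite mule_ge0// lee_fin sd_ge0.
- by move=> *; rewrite mule_ge0// lee_fin sd_ge0.
by apply: eq_esum => s _; rewrite !gee0_abs ?adde_ge0// ge0_muleDr.
Qed.

Lemma Ex1E S (D : subdist R S) : Ex D (fun=> 1) = \esum_(s in [set: S]) (D s)%:E.
Proof. by apply: eq_esum => s _; rewrite gee0_abs// mule1. Qed.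

Lemma Ex_scale S (D : subdist R S) (c : \bar R) :
  Ex D (fun=> c) = `|c| * Ex D (fun=> 1).
Proof. by rewrite Ex1E muleC -ge0_esumZr//; exact: sd_ge0. Qed.

Lemma fullE S (D : subdist R S) : full D <-> Ex D (fun=> 1) = 1.
Proof. by rewrite Ex1E. Qed.

Lemma Ex_full S (D : subdist R S) : full D -> Ex D (fun=> 1) = 1.
Proof. by move/fullE. Qed.

Lemma Ex1_le1 S (D : subdist R S) : Ex D (fun=> 1) <= 1.
Proof. by rewrite Ex1E sd_le1. Qed.

Lemma Ex_cst S (D : subdist R S) c : full D -> 0 <= c -> Ex D (fun=> c) = c.
Proof. by move=> /fullE D1 c0; rewrite Ex_scale D1 mule1 gee0_abs. Qed.

Lemma Ex_le S (D : subdist R S) f c : 0 <= c -> (forall s, 0 <= f s) ->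
  (forall s, D s != 0%R -> f s <= c) -> Ex D f <= c.
Proof.
move=> c0 f0 fc; apply: (@le_trans _ _ (Ex D (fun=> c))); first exact: le_Ex.
by rewrite Ex_scale gee0_abs// -[leRHS]mule1 lee_wpmul2l// Ex1_le1.
Qed.

Lemma Ex_supp S (D : subdist R S) f s : Ex D f = 0 -> D s != 0%R -> f s = 0.
Proof.
move=> Df Ds; apply/eqP; rewrite -abse_eq0.
have Ds0 : (0 < D s)%R by rewrite lt_neqAle sd_ge0 eq_sym andbT.
have : (D s)%:E * `|f s| <= 0.
  by rewrite -Df; apply: esum_ge; exists [set s]; [split|rewrite fsbig_set1].
have H : 0 <= (D s)%:E * `|f s| by rewrite mule_ge0// lee_fin sd_ge0.
move=> H1; have /eqP : (D s)%:E * `|f s| = 0 by apply/eqP; rewrite eq_le H H1.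
by rewrite mule_eq0 eqe (negbTE Ds).
Qed.

Lemma supp_neq0 S (D : subdist R S) s : (D s != 0%R) <-> Ex D (fun t => ((t == s)%:R : R)%:E) != 0.
Proof. by rewrite Ex_ind eqe. Qed.

Lemma Ex_neq0 S (D : subdist R S) f : Ex D f != 0 -> exists2 s, D s != 0%R & f s != 0.
Proof.
move=> Df; apply: contrapT => H; move/eqP: Df; apply.
apply: esum1 => s _; have [->|Ds] := eqVneq (D s) 0%R; first by rewrite mul0e.
have [->|fs] := eqVneq (f s) 0; first by rewrite abse0 mule0.
by exfalso; apply: H; exists s.
Qed.

Lemma Ex_eq0 S (D : subdist R S) f : (forall s, D s != 0%R -> f s = 0) -> Ex D f = 0.
Proof.
move=> H; apply: esum1 => s _; have [->|Ds] := eqVneq (D s) 0%R; first by rewrite mul0e.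
by rewrite H// abse0 mule0.
Qed.

Lemma supp_mix S I (p : subdist R I) (F : I -> subdist R S) s :
  (dmix p F s != 0%R) <-> exists2 i, p i != 0%R & F i s != 0%R.
Proof.
rewrite supp_neq0 Ex_mix; split => [/Ex_neq0[i pi /supp_neq0 Fi]|[i pi Fi]].
  by exists i.
apply/eqP => /Ex_supp /(_ pi); rewrite Ex_ind => -[] /eqP.
by rewrite (negbTE Fi).
Qed.

Lemma supp_push S U (g : S -> U) (D : subdist R S) u :
  (dpush g D u != 0%R) <-> exists2 s, D s != 0%R & g s = u.
Proof.
rewrite supp_neq0 Ex_push; split => [/Ex_neq0[s Ds /=]|[s Ds <-]].
  by case: (eqVneq (g s) u) => [gs _|_ /eqP//]; exists s.
apply/eqP => /Ex_supp /(_ Ds) /=; rewrite eqxx => -[] /eqP.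
by rewrite oner_eq0.
Qed.

Lemma supp_point S (s t : S) : (dpoint s t != 0%R :> R) <-> t = s.
Proof. by rewrite /= pnatr_eq0 eqb0 negbK; split => [/eqP//|->]. Qed.

Lemma supp_prod S U (A : subdist R S) (B : subdist R U) x :
  (dprod A B x != 0%R) <-> A x.1 != 0%R /\ B x.2 != 0%R.
Proof. by rewrite /= mulf_eq0 negb_or; split => /andP//. Qed.

Lemma full_push S U (g : S -> U) (D : subdist R S) : full (dpush g D) <-> full D.
Proof. by rewrite !fullE Ex_push. Qed.

Lemma full_mix S I (p : subdist R I) (F : I -> subdist R S) :
  full p -> (forall i, p i != 0%R -> full (F i)) -> full (dmix p F).
Proof.
move=> /fullE p1 F1; apply/fullE; rewrite Ex_mix -[RHS]p1.
by apply: eq_Ex => i /F1/fullE.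
Qed.

Lemma full_supp S (D : subdist R S) : full D -> exists s, D s != 0%R.
Proof.
move=> /fullE D1; have : Ex D (fun=> 1) != 0 by rewrite D1.
by move=> /Ex_neq0[s Ds _]; exists s.
Qed.

(** Monotone convergence: the outer sum is a supremum of finite partial sums, and each of these
    commutes with the increasing limit. *)
Lemma Ex_sup S (D : subdist R S) (f : nat -> S -> \bar R) :
  (forall n s, 0 <= f n s) -> (forall n s, f n s <= f n.+1 s) ->
  (forall n s, f n s <= 1) ->
  Ex D (fun s => ereal_sup (range (f ^~ s))) = ereal_sup (range (fun n => Ex D (f n))).
Proof.
move=> f0 fn f1.
have fmono s : {homo f ^~ s : n m / (n <= m)%N >-> n <= m}.
  move=> n m /subnK <-; elim: (m - n)%N => // k IH.
  exact: le_trans IH (fn _ _).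
have sup0 s : 0 <= ereal_sup (range (f ^~ s)).
  by apply: (le_trans (f0 0%N s)); apply: ereal_sup_ubound; exists 0%N.
have sup1 s : ereal_sup (range (f ^~ s)) <= 1.
  by apply: ge_ereal_sup => _ [n _ <-].
apply/eqP; rewrite eq_le; apply/andP; split; last first.
  apply: ge_ereal_sup => _ [n _ <-]; apply: le_Ex => // s _.
  by apply: ereal_sup_ubound; exists n.
apply: ge_ereal_sup => _ [X [finX _] <-].
have T0 n s : 0 <= (D s)%:E * `|f n s| by rewrite mule_ge0// lee_fin sd_ge0.
apply: (@le_trans _ _ (ereal_sup (range (fun n => \sum_(s \in X) ((D s)%:E * `|f n s|))))).
  (* The finite sum becomes a sum over a list, on which the limit is taken by induction. *)
  have [r Er] : exists r : seq S, forall h : S -> \bar R,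
      \sum_(s \in X) h s = \sum_(s <- r) h s.
    by exists (fset_set X : seq S) => h; rewrite fsbig_finite.
  have C : (fun n => \sum_(s <- r) ((D s)%:E * `|f n s|)) @ \oo -->
      \sum_(s <- r) ((D s)%:E * `|ereal_sup (range (f ^~ s))|).
    elim: r {Er} => [|s r IH].
      rewrite big_nil; under eq_fun do rewrite big_nil; exact: cvg_cst.
    rewrite big_cons; under eq_fun do rewrite big_cons.
    apply: cvgeD => //.
      apply: ge0_adde_def; rewrite inE; first by rewrite mule_ge0// lee_fin sd_ge0.
      by apply: sume_ge0 => t _; rewrite mule_ge0// lee_fin sd_ge0.
    apply: cvgeZl => //; rewrite gee0_abs//.
    under eq_fun do rewrite gee0_abs//.
    exact: ereal_nondecreasing_cvgn (fmono s).
  rewrite Er -(cvg_lim _ C)//; apply: lime_le; first by apply/cvg_ex; eexists; exact: C.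
  by apply: nearW => n; apply: ereal_sup_ubound; exists n => //; rewrite Er.
apply: ge_ereal_sup => _ [n _ <-].
apply: (@le_trans _ _ (Ex D (f n))); last by apply: ereal_sup_ubound; exists n.
by apply: esum_ge; exists X.
Qed.

Lemma dzero_le1 S : \esum_(s in [set: S]) (0%R : R)%:E <= 1.
Proof. by rewrite esum1. Qed.

Definition dzero S : subdist R S := SubDist (fun _ => lexx 0%R) (dzero_le1 S).

Lemma Ex_zero S f : Ex (dzero S) f = 0.
Proof. by apply: Ex_eq0 => s; rewrite eqxx. Qed.

(** * Conditioning on the value of a function *)

Section Cond.
Variables (S U : choiceType) (D : subdist R S) (g : S -> U) (u : U).

Let c (s : S) : R := if dpush g D u == 0%R then 0%R
  else ((g s == u)%:R * D s / dpush g D u)%R.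

Lemma cond_ge0 s : (0 <= c s)%R.
Proof.
rewrite /c; case: ifP => // _.
by rewrite divr_ge0 ?sd_ge0// mulr_ge0 ?sd_ge0.
Qed.

Lemma pushE : (dpush g D u)%:E = \esum_(s in [set: S]) ((g s == u)%:R * D s)%:E.
Proof.
rewrite -Ex_ind Ex_push; apply: eq_esum => s _.
by rewrite gee0_abs ?lee_fin ?ler0n// -EFinM mulrC.
Qed.

Lemma cond_sum : dpush g D u != 0%R -> \esum_(s in [set: S]) (c s)%:E = 1.
Proof.
move=> m0; rewrite /c (negbTE m0).
under eq_esum do rewrite mulrC EFinM.
rewrite ge0_esumZl ?invr_ge0 ?sd_ge0//; last first.
  by move=> s; rewrite lee_fin mulr_ge0 ?sd_ge0.
by rewrite -pushE -EFinM mulVf.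
Qed.

Lemma cond_le1 : \esum_(s in [set: S]) (c s)%:E <= 1.
Proof.
have [m0|/cond_sum ->//] := eqVneq (dpush g D u) 0%R.
by rewrite /c m0 eqxx esum1.
Qed.

(* Zero if the event [g = u] is null. *)
Definition dcond : subdist R S := SubDist cond_ge0 cond_le1.

Lemma dcond_full : dpush g D u != 0%R -> full dcond.
Proof. exact: cond_sum. Qed.

Lemma supp_dcond s : dcond s != 0%R -> g s = u /\ D s != 0%R.
Proof.
rewrite /= /c; case: ifP => _; first by rewrite eqxx.
by rewrite !mulf_eq0 !negb_or pnatr_eq0 eqb0 negbK => /andP[/andP[/eqP -> ->]].
Qed.

End Cond.

Lemma dcondE S U (D : subdist R S) (g : S -> U) (u : U) s :
  dpush g D u != 0%R -> dcond D g u s = ((g s == u)%:R * D s / dpush g D u)%R.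
Proof. by move=> /= /negbTE ->. Qed.

(** Law of total expectation. It lets the play draw its random choices late, from the current state
    alone, without changing any average. *)
Lemma Ex_dcond S U (D : subdist R S) (g : S -> U) f :
  Ex (dpush g D) (fun u => Ex (dcond D g u) f) = Ex D f.
Proof.
suff E : dmix (dpush g D) (dcond D g) = D by rewrite -[in RHS]E Ex_mix.
apply: sd_eqEx => h h0; rewrite Ex_mix Ex_push.
have key s : D s != 0%R -> dpush g D (g s) != 0%R.
  by move=> Ds; apply/supp_push; exists s.
rewrite /Ex.
transitivity (\esum_(s in [set: S]) \esum_(t in [set: S])
   ((D s * (g t == g s)%:R * D t / dpush g D (g s))%:E * `|h t|)).
  apply: eq_esum => s _; rewrite gee0_abs ?Ex_ge0//.
  rewrite -ge0_esumZl ?sd_ge0//; last first.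
    by move=> t; rewrite mule_ge0// lee_fin sd_ge0.
  apply: eq_esum => t _; have [->|Ds] := eqVneq (D s) 0%R.
    by rewrite !mul0r !mul0e.
  by rewrite dcondE ?key// muleA -EFinM !mulrA.
rewrite esum_exchange; last first.
  by move=> s t; rewrite mule_ge0// lee_fin divr_ge0 ?sd_ge0// !mulr_ge0 ?sd_ge0.
apply: eq_esum => t _.
have [Dt|Dt] := eqVneq (D t) 0%R.
  by rewrite Dt mul0e esum1// => s _; rewrite mulr0 mul0r mul0e.
(* For fixed [t], the masses of the [s] in the fibre of [t] sum to the mass of that fibre, which
   cancels the denominator. *)
transitivity (\esum_(s in [set: S])
   (((g s == g t)%:R * D s)%:E * ((D t / dpush g D (g t))%:E * `|h t|))).
  apply: eq_esum => s _; rewrite muleA -EFinM; congr (_%:E * _).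
  rewrite eq_sym; case: eqP => [->|_]; last by rewrite !(mulr0, mul0r).
  by rewrite mulr1 mul1r mulrA.
rewrite ge0_esumZr; last 2 first.
- by move=> s; rewrite mulr_ge0 ?sd_ge0.
- by rewrite mule_ge0// lee_fin divr_ge0 ?sd_ge0.
by rewrite -pushE muleA -EFinM mulrC divfK ?key.
Qed.

End Calculus.
#[global] Hint Resolve Ex_ge0 : core.

(** * Couplings and weak derivations *)

Section Monad.
Context {R : realType}.
Implicit Types S U I J : choiceType.
Local Open Scope ereal_scope.

Lemma push_point S U (g : S -> U) (s : S) :
  dpush g (dpoint s) = dpoint (g s) :> subdist R U.
Proof. by apply: sd_eqEx => f f0; rewrite Ex_push !Ex_point /=. Qed.

Lemma mix_point S I (F : I -> subdist R S) (i : I) : dmix (dpoint i) F = F i.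
Proof. by apply: sd_eqEx => f f0; rewrite Ex_mix Ex_point. Qed.

Lemma mix_dpoint S I (p : subdist R I) (g : I -> S) :
  dmix p (fun i => dpoint (g i)) = dpush g p.
Proof.
by apply: sd_eqEx => f f0; rewrite Ex_mix Ex_push; apply: eq_Ex => i _; rewrite Ex_point.
Qed.

Lemma push_mix S U I (g : S -> U) (p : subdist R I) (F : I -> subdist R S) :
  dpush g (dmix p F) = dmix p (fun i => dpush g (F i)).
Proof.
apply: sd_eqEx => f f0; rewrite Ex_push !Ex_mix.
by apply: eq_Ex => i _; rewrite Ex_push.
Qed.

Lemma mix_mix S I J (p : subdist R I) (q : I -> subdist R J) (F : J -> subdist R S) :
  dmix (dmix p q) F = dmix p (fun i => dmix (q i) F).
Proof.
apply: sd_eqEx => f f0; rewrite !Ex_mix.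
by apply: eq_Ex => i _; rewrite Ex_mix.
Qed.

Lemma push_push S U J (g : S -> U) (h : U -> J) (D : subdist R S) :
  dpush h (dpush g D) = dpush (h \o g) D.
Proof. by apply: sd_eqEx => f f0; rewrite !Ex_push. Qed.

Lemma eq_mix S I (p : subdist R I) (F G : I -> subdist R S) :
  (forall i, p i != 0%R -> F i = G i) -> dmix p F = dmix p G.
Proof.
by move=> FG; apply: sd_eqEx => f f0; rewrite !Ex_mix; apply: eq_Ex => i /FG ->.
Qed.

Lemma full_point S (s : S) : full (dpoint s : subdist R S).
Proof. exact: dpoint_full. Qed.

Lemma dadd_ex S (A B : subdist R S) : Ex A (fun=> 1) + Ex B (fun=> 1) <= 1 ->
  exists M : subdist R S, (forall s, M s = A s + B s)%R /\
    forall f, Ex M f = Ex A f + Ex B f.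
Proof.
move=> AB1.
have ge0 s : (0 <= A s + B s)%R by rewrite addr_ge0 ?sd_ge0.
have le1 : \esum_(s in [set: S]) (A s + B s)%:E <= 1.
  apply: le_trans AB1; rewrite !Ex1E -esumD//.
  - by move=> *; rewrite lee_fin sd_ge0.
  - by move=> *; rewrite lee_fin sd_ge0.
exists (SubDist ge0 le1); split => // f; rewrite /Ex -esumD; last 2 first.
- by move=> *; rewrite mule_ge0// lee_fin sd_ge0.
- by move=> *; rewrite mule_ge0// lee_fin sd_ge0.
by apply: eq_esum => s _ /=; rewrite EFinD ge0_muleDl// lee_fin sd_ge0.
Qed.

(** Written as a mixture with the zero subdistribution, so that the calculus of mixtures applies to
    it. *)
Definition drestrict S (D : subdist R S) (b : pred S) : subdist R S :=
  dmix D (fun s => if b s then dpoint s else dzero S).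

Lemma Ex_restrict S (D : subdist R S) (b : pred S) f : (forall s, 0 <= f s) ->
  Ex (drestrict D b) f = Ex D (fun s => if b s then f s else 0).
Proof.
move=> f0; rewrite Ex_mix; apply: eq_Ex => s _.
by case: ifP => _; rewrite ?Ex_point ?Ex_zero.
Qed.

Lemma restrictE S (D : subdist R S) (b : pred S) s :
  drestrict D b s = (if b s then D s else 0)%R.
Proof.
apply: EFin_inj; rewrite -Ex_ind Ex_restrict; last by move=> t; rewrite lee_fin ler0n.
transitivity (Ex D (fun t => (if b s then 1 else 0) * ((t == s)%:R : R)%:E)).
  apply: eq_Ex => t _; case: eqP => [->|_]; last by rewrite mule0; case: ifP.
  by rewrite mule1; case: ifP.
case: ifP => _; last by apply: Ex_eq0 => t _; rewrite mul0e.
by rewrite -Ex_ind; apply: eq_Ex => t _; rewrite mul1e.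
Qed.

Lemma Ex_split S (D : subdist R S) (b : pred S) f : (forall s, 0 <= f s) ->
  Ex D f = Ex (drestrict D b) f + Ex (drestrict D (predC b)) f.
Proof.
move=> f0; rewrite !Ex_restrict// -Ex_add; last 2 first.
- by move=> s; case: ifP.
- by move=> s; case: ifP.
by apply: eq_Ex => s _ /=; case: ifP; rewrite ?adde0 ?add0e.
Qed.

Lemma Ex_series S (D : subdist R S) (X : nat -> subdist R S) f :
  (forall s, (D s)%:E = \esum_(k in [set: nat]) (X k s)%:E)%E ->
  Ex D f = \esum_(k in [set: nat]) Ex (X k) f.
Proof.
move=> H'.
rewrite /Ex; transitivity (\esum_(s in [set: S]) \esum_(k in [set: nat])
    ((X k s)%:E * `|f s|))%E.
  apply: eq_esum => s _; rewrite H'.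
  by rewrite -ge0_esumZr// => k; exact: sd_ge0.
by rewrite esum_exchange// => s k; rewrite mule_ge0// lee_fin sd_ge0.
Qed.

Lemma series_ex S (X : nat -> subdist R S) :
  \esum_(k in [set: nat]) Ex (X k) (fun=> 1) <= 1 ->
  exists D : subdist R S, forall s, (D s)%:E = \esum_(k in [set: nat]) (X k s)%:E.
Proof.
move=> X1; pose g s := \esum_(k in [set: nat]) (X k s)%:E.
have X0 k s : 0 <= (X k s)%:E by rewrite lee_fin sd_ge0.
have g0 s : 0 <= g s by exact: esum_ge0.
have g1 : \esum_(s in [set: S]) g s <= 1.
  by rewrite /g esum_exchange//; under eq_esum do rewrite -Ex1E.
by exists (of_ereal g0 g1) => s /=; rewrite of_ereal_finE.
Qed.

End Monad.

(** * Couplings that witness a lifted relation *)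

Section Coupling.
Context {R : realType} {S : choiceType}.
Implicit Types (X : S -> subdist R S -> Prop) (G D : subdist R S).

(** With a classical choice structure, subdistributions can be drawn at random like states. *)
Definition sdT : choiceType := {classic (subdist R S)}.

Definition sdv (E : sdT) : subdist R S := E.

(** A draw from [W] is a state with a subdistribution related to it. One joint law replaces the
    nested mixtures in a derivation of [lift], and it can be conditioned. *)
Definition coupling X G D (W : subdist R (S * sdT)%type) : Prop :=
  [/\ forall x, W x != 0 -> X x.1 x.2, dpush fst W = G & dmix W (sdv \o snd) = D].

Lemma lift_coupling X G D : lift X G D -> exists W, coupling X G D W.
Proof.
elim=> {G D} [s D XsD|I p G D _ IH].
  exists (dpoint (s, D : sdT)); split; first by move=> x /supp_point ->.
    by rewrite push_point.
  by rewrite mix_point.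
have [W HW] := choice IH; exists (dmix p W); split.
- by move=> x /supp_mix[i pi Wi]; have [H _ _] := HW i; exact: H.
- by rewrite push_mix; apply: eq_mix => i _; case: (HW i).
- by rewrite mix_mix; apply: eq_mix => i _; case: (HW i).
Qed.

Lemma lift_zero X : lift X (dzero S) (dzero S).
Proof.
have -> : dzero S = dmix (dzero void) (fun=> dzero S) :> subdist R S.
  by apply: sd_eqEx => f _; rewrite Ex_mix !Ex_zero.
by apply: lift_mix => -[].
Qed.

(** [lift_mix] asks for related families at every index; at indices of weight zero both members are
    replaced by the zero subdistribution, which is related to itself. *)
Lemma lift_mix_supp (I : choiceType) X (p : subdist R I) (G D : I -> subdist R S) :
  (forall i, p i != 0 -> lift X (G i) (D i)) -> lift X (dmix p G) (dmix p D).
Proof.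
move=> H.
have -> : dmix p G = dmix p (fun i => if p i == 0 then dzero S else G i).
  by apply: eq_mix => i /negbTE ->.
have -> : dmix p D = dmix p (fun i => if p i == 0 then dzero S else D i).
  by apply: eq_mix => i /negbTE ->.
apply: lift_mix => i; have [_|/H//] := eqVneq (p i) 0; exact: lift_zero.
Qed.

End Coupling.
Arguments sdT R S : clear implicits.

(** * Weak derivations with explicit transitions *)

Section Derivation.
Context {R : realType} {S : choiceType} {L : Type}.
Variable Q : plts R S L.
Implicit Types D : subdist R S.

Definition target (m : (S * option (sdT R S))%type) : subdist R S :=
  if m.2 is Some E then sdv E else dzero S.

(* [N k (s, None)] and [N k (s, Some E)] are the masses that, after [k] steps,
   stop in [s] and leave [s] by the transition to [E]. *)
Definition derivation (N : nat -> subdist R (S * option (sdT R S))%type) D D' : Prop :=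
  [/\ dpush fst (N 0%N) = D,
      forall k, dpush fst (N k.+1) = dmix (N k) target,
      forall k s E, N k (s, Some E) != 0 -> trans Q s None E &
      forall f, (forall s, 0 <= f s)%E -> (Ex D' f = \esum_(k in [set: nat])
        Ex (N k) (fun m => if m.2 is None then f m.1 else 0))%E].

(** The stopping part is tagged with [None], and the moving part with the transition drawn from a
    coupling for its lifted move; their sum is the law of the step. *)
Lemma wtau_derivation D D' : wtau Q D D' -> exists N, derivation N D D'.
Proof.
move=> [Dto [Dx [H0 H1 H']]].
have /choice[E HE] : forall k, exists E : subdist R S, ltrans Q None (Dto k) E /\
    forall s, E s = Dto k.+1 s + Dx k.+1 s.
  by move=> k; have [E] := H1 k; exists E.
have /choice[W HW] : forall k, exists W,
    coupling (fun s D => trans Q s None D) (Dto k) (E k) W.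
  by move=> k; apply: lift_coupling; case: (HE k).
pose A k := dpush (fun s => (s, None : option (sdT R S))) (Dx k).
pose B k := dpush (fun x : (S * sdT R S)%type => (x.1, Some x.2)) (W k).
have HAB k f : (forall s, 0 <= f s)%E -> (Ex (A k) (f \o fst) + Ex (B k) (f \o fst) =
    \esum_(s in [set: S]) ((Dto k s + Dx k s)%:E * `|f s|))%E.
  move=> f0; have [_ W1 _] := HW k; rewrite !Ex_push.
  rewrite [X in (_ + X)%E](_ : _ = Ex (Dto k) f); last by rewrite -W1 Ex_push.
  rewrite /Ex -esumD; last 2 first.
  - by move=> *; rewrite mule_ge0// lee_fin sd_ge0.
  - by move=> *; rewrite mule_ge0// lee_fin sd_ge0.
  apply: eq_esum => s _ /=; rewrite EFinD ge0_muleDl ?lee_fin ?sd_ge0//.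
  by rewrite addeC.
pose C k := if k is k'.+1 then E k' else D.
have HC k s : C k s = Dto k s + Dx k s.
  by case: k => [|k]; [exact: H0|case: (HE k)].
have HABC k f : (forall s, 0 <= f s)%E ->
    (Ex (A k) (f \o fst) + Ex (B k) (f \o fst) = Ex (C k) f)%E.
  by move=> f0; rewrite HAB//; apply: eq_esum => s _; rewrite HC.
have /choice[N HN] : forall k, exists N : subdist R (S * option (sdT R S))%type,
    (forall x, N x = A k x + B k x) /\
    forall f, Ex N f = (Ex (A k) f + Ex (B k) f)%E.
  move=> k; apply: dadd_ex.
  by have := HABC k (fun=> 1%E) (fun=> lee01); rewrite /comp => ->; exact: Ex1_le1.
have NC k : dpush fst (N k) = C k.
  by apply: sd_eqEx => f f0; rewrite Ex_push; have [_ ->] := HN k; rewrite HABC.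
exists N; split => //.
- move=> k; rewrite NC /=; have [_ _ <-] := HW k.
  apply: sd_eqEx => f f0; rewrite !Ex_mix; have [_ ->] := HN k.
  rewrite !Ex_push [X in (X + _)%E]Ex_eq0 ?add0e//.
  by move=> s _ /=; rewrite Ex_zero.
- move=> k s F; have [-> _] := HN k => NF.
  have : B k (s, Some F) != 0.
    by apply/eqP => B0; move: NF; rewrite B0 addr0 => /supp_push[t _ []].
  move=> /supp_push[[t G] WtG /= [<- <-]].
  by have [H _ _] := HW k; exact: H WtG.
- move=> f f0; transitivity (\esum_(k in [set: nat]) Ex (Dx k) f)%E; last first.
    apply: eq_esum => k _; have [_ ->] := HN k.
    by rewrite !Ex_push [X in (_ + X)%E]Ex_eq0 ?adde0.
  exact: Ex_series.
Qed.

Lemma wtau_refl D : wtau Q D D.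
Proof.
exists (fun=> dzero S), (fun k => if k is 0%N then D else dzero S); split.
- by move=> s /=; rewrite add0r.
- move=> k; exists (dzero S); first exact: lift_zero.
  by move=> s /=; rewrite addr0.
- move=> s; rewrite -[LHS](@esum_set1 R nat 0%N (fun=> (D s)%:E)) ?lee_fin ?sd_ge0//.
  rewrite esum_mkcond; apply: eq_esum => -[|k] _; first by rewrite mem_set.
  by rewrite memNset.
Qed.

End Derivation.

(** * Values *)

Section Iterates.
Context {R : realType} {Q : choiceType} {W : Type}.
Variables (s : Q -> W -> bool) (k : Q -> option (subdist R Q)).
Local Open Scope ereal_scope.

(** Kleene iterates of the value functional, for any success predicate and any partial kernel, so
    that one theory serves both the given resolution and the play. Success counts already in iterate
    zero. *)
Fixpoint itv (n : nat) (r : Q) (w : W) : \bar R :=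
  if s r w then 1 else
  if n is n'.+1 then if k r is Some mu then Ex mu (itv n' ^~ w) else 0 else 0.

Lemma itv_ge0 n r w : 0 <= itv n r w.
Proof. by case: n => [|n] /=; case: ifP => // _; case: (k r). Qed.
Hint Resolve itv_ge0 : core.

Lemma itv_le1 n r w : itv n r w <= 1.
Proof.
elim: n r => [|n IH] r /=; case: ifP => // _; case: (k r) => // mu.
exact: Ex_le.
Qed.

Lemma itv_mono n r w : itv n r w <= itv n.+1 r w.
Proof.
elim: n r => [|n IH] r /=; case: ifP => // _; case: (k r) => // mu.
by apply: le_Ex => // r' _; exact: IH.
Qed.

Definition lval r w : \bar R := ereal_sup (range (fun n => itv n r w)).

Lemma itv_val n r w : itv n r w <= lval r w.
Proof. by apply: ereal_sup_ubound; exists n. Qed.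

Lemma lval_ge0 r w : 0 <= lval r w.
Proof. exact: le_trans (itv_val 0 r w). Qed.
Hint Resolve lval_ge0 : core.

Lemma lval_le1 r w : lval r w <= 1.
Proof. by apply: ge_ereal_sup => _ [n _ <-]; exact: itv_le1. Qed.

Lemma lval_fin r w : lval r w \is a fin_num.
Proof. by rewrite ge0_fin_numE// (le_lt_trans (lval_le1 r w))// ltry. Qed.

Lemma Ex_val mu w : Ex mu (lval ^~ w) = ereal_sup (range (fun n => Ex mu (itv n ^~ w))).
Proof.
by apply: Ex_sup => // *; [exact: itv_mono|exact: itv_le1].
Qed.

Lemma lval_fix r w : lval r w =
  if s r w then 1 else if k r is Some mu then Ex mu (lval ^~ w) else 0.
Proof.
apply/eqP; rewrite eq_le; apply/andP; split.
  apply: ge_ereal_sup => _ [n _ <-]; case: n => [|n] /=; case: ifP => //.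
    by move=> _; case: (k r) => [mu|//]; exact: Ex_ge0.
  by move=> _; case: (k r) => // mu; apply: le_Ex => // r' _; exact: itv_val.
case: ifP => srw; first by have := itv_val 0 r w; rewrite /= srw.
case E : (k r) => [mu|//]; rewrite Ex_val.
by apply: ge_ereal_sup => _ [n _ <-]; have := itv_val n.+1 r w; rewrite /= srw E.
Qed.

Lemma lval_least (g : Q -> W -> \bar R) w : (forall r, 0 <= g r w) ->
  (forall r, (if s r w then 1 else if k r is Some mu then Ex mu (g ^~ w) else 0) <= g r w) ->
  forall r, lval r w <= g r w.
Proof.
move=> g0 gfix r; apply: ge_ereal_sup => _ [n _ <-].
elim: n r => [|n IH] r; apply: le_trans (gfix r) => /=; case: ifP => // _; case: (k r) => // mu.
exact: le_Ex.
Qed.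

(** An abstract form of condition (B) on tests. It removes the success case from the recursive
    equations for values and iterates. *)
Definition persistent := forall r mu, k r = Some mu -> full mu /\
  forall r' w, mu r' != 0%R -> s r w -> s r' w.

Hypothesis pers : persistent.

Lemma itv_succ n r w : s r w -> itv n r w = 1.
Proof. by case: n => /= [|n] ->. Qed.

Lemma lval_succ r w : s r w -> lval r w = 1.
Proof. by rewrite lval_fix => ->. Qed.

(** In the success case all successors succeed too, and since [mu] is full their average is one. *)
Lemma itv_step n r mu w : k r = Some mu -> itv n.+1 r w = Ex mu (itv n ^~ w).
Proof.
move=> E; rewrite /= E; case: ifP => // srw; have [fmu H] := pers E.
rewrite (@eq_Ex _ _ _ _ (fun=> 1)); first by rewrite Ex_cst.
by move=> r' r'0; rewrite itv_succ// (H r').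
Qed.

Lemma lval_step r mu w : k r = Some mu -> lval r w = Ex mu (lval ^~ w).
Proof.
move=> E; rewrite lval_fix E; case: ifP => // srw; have [fmu H] := pers E.
rewrite (@eq_Ex _ _ _ _ (fun=> 1)); first by rewrite Ex_cst.
by move=> r' r'0; rewrite lval_succ// (H r').
Qed.

End Iterates.
#[global] Hint Resolve itv_ge0 : core.
#[global] Hint Resolve lval_ge0 : core.

Section Value.
Context {R : realType} {Q Omega : choiceType} (QQ : plts R Q Omega).

Definition succeeds (r : Q) (w : Omega) : bool := `[< enables QQ r (Some w) >].

Definition tau_next (r : Q) : option (subdist R Q) :=
  if pselect (enables QQ r None) is left h then Some (projT1 (cid h)) else None.

Lemma tau_next_trans r mu : tau_next r = Some mu -> trans QQ r None mu.
Proof.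
by rewrite /tau_next; case: pselect => // h [<-]; case: cid.
Qed.

Lemma tau_next_None r : tau_next r = None -> ~ enables QQ r None.
Proof. by rewrite /tau_next; case: pselect. Qed.

Lemma tau_next_det r mu : deterministic QQ -> trans QQ r None mu -> tau_next r = Some mu.
Proof.
move=> det t; case E : (tau_next r) => [mu'|].
  by congr Some; apply: det (tau_next_trans E) t.
by exfalso; apply: (tau_next_None E); exists mu.
Qed.

Lemma expectE (D : subdist R Q) (f : Q -> R) : (forall r, 0 <= f r)%R ->
  expect D f = fine (Ex D (fun r => (f r)%:E)).
Proof.
move=> f0; congr fine; apply: eq_esum => r _.
by rewrite gee0_abs ?lee_fin// EFinM.
Qed.

Lemma Ex_fin (D : subdist R Q) (f : Q -> \bar R) :
  (forall r, 0 <= f r <= 1)%E -> (Ex D f \is a fin_num)%E.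
Proof.
move=> f01; have D1 : (Ex D f <= 1)%E.
  by apply: Ex_le => // r; have /andP[] := f01 r.
rewrite ge0_fin_numE; first exact: le_lt_trans D1 (ltry _).
exact: Ex_ge0.
Qed.

Lemma value_stepE (g : Q -> Omega -> R) r w : (forall r w, 0 <= g r w <= 1) ->
  (value_step QQ g r w)%:E = (if succeeds r w then 1 else
     if tau_next r is Some mu then Ex mu (fun r' => (g r' w)%:E) else 0)%E.
Proof.
move=> g01; rewrite /value_step -/(succeeds r w) /tau_next; case: ifP => // _.
case: pselect => // h; rewrite expectE; last by move=> r'; have /andP[] := g01 r' w.
by rewrite fineK// Ex_fin// => r'; rewrite !lee_fin.
Qed.

(** Identifies the least fixed point with the supremum of the iterates, which is what all later
    bounds work with. *)
Lemma value_fine : value QQ (fun r w => fine (lval (R := R) succeeds tau_next r w)).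
Proof.
have v01 r w : 0 <= fine (lval (R := R) succeeds tau_next r w) <= 1.
  rewrite -!lee_fin fineK; last exact: lval_fin.
  by rewrite lval_ge0 lval_le1.
have vK r w : (fine (lval (R := R) succeeds tau_next r w))%:E = lval succeeds tau_next r w.
  by rewrite fineK//; exact: lval_fin.
split; first split => //.
  apply/funext => r; apply/funext => w; apply: EFin_inj.
  rewrite value_stepE// vK lval_fix; case: ifP => // _; case: (tau_next r) => // mu.
  by apply: eq_Ex => r' _; rewrite vK.
move=> g [g01 gfix] r w; rewrite -lee_fin vK.
apply: (lval_least (g := fun r w => (g r w)%:E)) => {}r.
  by rewrite lee_fin; have /andP[] := g01 r w.
by rewrite -value_stepE// gfix.
Qed.

Lemma value_val V : value QQ V -> forall r w, (V r w)%:E = lval succeeds tau_next r w.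
Proof.
move=> [V1 V2] r w; have [F1 F2] := value_fine.
have -> : V r w = fine (lval (R := R) succeeds tau_next r w).
  apply/eqP; rewrite eq_le; apply/andP; split; first exact: V2 F1 r w.
  exact: F2.
by rewrite fineK//; exact: lval_fin.
Qed.

Lemma expect_value V (D : subdist R Q) w : value QQ V ->
  (expect D (V ^~ w))%:E = Ex D (lval succeeds tau_next ^~ w).
Proof.
move=> HV; have [[V01 _] _] := HV.
rewrite expectE; last by move=> r; have /andP[] := V01 r w.
rewrite fineK; last by apply: Ex_fin => r; rewrite !lee_fin; exact: V01.
by apply: eq_Ex => r _; rewrite (value_val HV).
Qed.

End Value.

(** * Convergence *)

Section Telescope.
Context {R : realType}.
Local Open Scope ereal_scope.

Lemma esum_nat_ge (a : nat -> \bar R) n : (forall k, 0 <= a k) ->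
  \sum_(k < n) a k <= \esum_(k in [set: nat]) a k.
Proof.
move=> a0; rewrite -nneseries_esumT// -(big_mkord xpredT a).
exact: nneseries_lim_ge.
Qed.

Lemma esum_nat_le (a : nat -> \bar R) c : (forall k, 0 <= a k) ->
  (forall n, \sum_(k < n) a k <= c) -> \esum_(k in [set: nat]) a k <= c.
Proof.
move=> a0 ac; rewrite -nneseries_esumT//; apply: lime_le.
  exact: is_cvg_nneseries.
by apply: nearW => n; rewrite big_mkord.
Qed.

Lemma esum_neq0 (I : choiceType) (a : I -> \bar R) :
  \esum_(i in [set: I]) a i != 0 -> exists i, a i != 0.
Proof.
move=> H; apply: contrapT => /forallNP a0; move/eqP: H; apply; apply: esum1 => i _.
by apply/eqP/negPn/negP; exact: a0.
Qed.

(** [a] is a potential that pays [b] at every step, so the payments total at most the initial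
    potential. *)
Lemma telescope_ge (a b : nat -> \bar R) : (forall k, 0 <= a k) ->
  (forall k, 0 <= b k) -> (forall k, b k + a k.+1 <= a k) ->
  \esum_(k in [set: nat]) b k <= a 0%N.
Proof.
move=> a0 b0 ba; apply: esum_nat_le => // n.
apply: (@le_trans _ _ (\sum_(k < n) b k + a n)); first by rewrite leeDl.
elim: n => [|n IH]; first by rewrite big_ord0 add0e.
by apply: le_trans IH; rewrite big_ord_recr /= -addeA leeD2l.
Qed.

(** The first index of [a] is fuel, spent one unit per step. Nothing is left when it runs out, so
    [a m 0] is covered by the payments made on the way, each of them bounded by [c]. *)
Lemma telescope_le (a b : nat -> nat -> \bar R) (c : nat -> \bar R) m :
  (forall k, 0 <= c k) -> (forall k, a 0%N k = 0) ->
  (forall m k, a m.+1 k <= b m k + a m k.+1) ->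
  (forall j k, (j < m)%N -> b j k <= c k) ->
  a m 0%N <= \esum_(k in [set: nat]) c k.
Proof.
move=> c0 a0 ab bc.
suff H j k : (j <= m)%N -> a j k <= \sum_(i < j) c (k + i)%N.
  by apply: (le_trans (H m 0%N (leqnn m))); exact: esum_nat_ge.
elim: j k => [|j IH] k jm; first by rewrite a0 big_ord0.
rewrite big_ord_recl addn0; apply: (le_trans (ab j k)); apply: leeD; first exact: bc.
apply: (le_trans (IH k.+1 (ltnW jm))).
by apply: lee_sum => i _; rewrite addSnnS.
Qed.

Lemma Ex_scalel (S : choiceType) (D : subdist R S) (c : R) (f : S -> R) : (0 <= c)%R ->
  (forall s, 0 <= f s)%R -> Ex D (fun s => (c * f s)%:E) = c%:E * Ex D (fun s => (f s)%:E).
Proof.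
move=> c0 f0; rewrite /Ex -ge0_esumZl//; last first.
  by move=> s; rewrite mule_ge0// lee_fin sd_ge0.
by apply: eq_esum => s _; rewrite !gee0_abs ?lee_fin ?mulr_ge0// EFinM muleCA.
Qed.

End Telescope.

Section Convergence.
Context {R : realType} {S : choiceType} {L : Type}.
Variables (Q : plts R S L) (D0 : subdist R S).
Hypotheses (finD : finitary Q D0) (convD : convergent Q D0).

(** Otherwise each state of [X] has an internal step that stays in [X]. Following these steps from
    [s0] for ever gives an infinite sequence of full distributions on reachable states, against
    convergence. *)
Lemma tau_escape (X : set S) s0 : X s0 -> (forall s, X s -> reachable Q D0 s) ->
  exists s, X s /\
    forall E, trans Q s None E -> exists u, E u != 0 /\ ~ X u.
Proof.
move=> Xs0 Xr; apply: contrapT => /forallNP H; apply: convD.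
have /choice[e He] : forall s, exists E, X s ->
    trans Q s None E /\ forall u, E u != 0 -> X u.
  move=> s; have [Xs|] := pselect (X s); last by exists D0.
  have /not_andP[//|/existsNP[E /not_implyP[tE /forallNP HE]]] := H s.
  exists E => _; split => // u Eu; apply: contrapT => Xu.
  by apply: (HE u).
pose E n := iter n (fun D => dmix D e) (dpoint s0).
have EX n s : E n s != 0 -> X s.
  elim: n s => [|n IH] s; first by move=> /supp_point ->.
  by move=> /supp_mix[t /IH Xt]; have [_ + ?] := He t Xt; apply.
exists E; split.
- elim=> [|n IH]; first exact: full_point.
  apply: full_mix => // s Es; have [/trans_full//] := He s (EX n s Es).
- by move=> s Es; apply: Xr; exact: (EX 0%N).
- move=> n; rewrite /ltrans.
  have {1}-> : E n = dmix (E n) (fun s => dpoint s).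
    by rewrite mix_dpoint; apply: sd_eqEx => f _; rewrite Ex_push.
  by apply: lift_mix_supp => s Es; apply: lift_point; case: (He s (EX n s Es)).
Qed.

(** Makes one scaling factor work for all of the finitely many moves of a state. *)
Lemma large_multiple (T : Type) (x : T -> R) (l : list T) :
  exists2 A, 1 <= A & forall E, List.In E l -> 0 < x E -> 2 <= A * x E.
Proof.
elim: l => [|E l [A A1 HA]]; first by exists 1.
have [xE|xE] := ltP 0 (x E); last first.
  by exists A => // F [<-|Fl]; [rewrite ltNge xE|exact: HA].
exists (A + 2 / x E).
  by rewrite (le_trans A1)// lerDl divr_ge0// ltW.
move=> F [<- _|/HA H xF].
  rewrite mulrDl divfK ?gt_eqF// lerDr; apply: mulr_ge0; last exact: ltW.
  exact: le_trans A1.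
apply: (le_trans (H xF)); apply: ler_wpM2r; first exact: ltW.
by rewrite lerDl divr_ge0// ltW.
Qed.

(* [U] grows by at least one, in expectation, at every internal step, so that
   only a bounded number of steps is expected. It is built state by state:
   [tau_escape] yields a state all of whose internal steps may lead into the
   set where [U] is already positive; scaling [U] up makes room for it. *)
Lemma potential : exists (U : S -> R) (M : R), (forall s, 0 <= U s <= M) /\
  forall s E, reachable Q D0 s -> trans Q s None E ->
    ((U s)%:E + 1 <= Ex E (fun u => (U u)%:E))%E.
Proof.
have [/finite_seqP[rs Hrs] finT] := finD.
(* Stage [n]: steps from reachable states where [U] is positive make it grow, and either all
   reachable states are such or at least [n] distinct ones are. *)
pose P n := exists (U : S -> R) (M : R), [/\ (forall s, 0 <= U s <= M),
  (forall s, U s = 0 \/ 1 <= U s),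
  (forall s E, reachable Q D0 s -> U s != 0 -> trans Q s None E ->
    ((U s)%:E + 1 <= Ex E (fun u => (U u)%:E))%E) &
  (forall s, reachable Q D0 s -> U s != 0) \/
  exists l : seq S, [/\ uniq l, size l = n & forall s, s \in l -> reachable Q D0 s /\ U s != 0]].
have HP n : P n.
  elim: n => [|n [U [M [U0 U1 HU [Ur|[l [lu ln lr]]]]]]].
  - exists (fun=> 0), 0; split; first by move=> _; rewrite lexx.
    + by left.
    + by move=> s E _ /eqP.
    + by right; exists [::].
  - by exists U, M; split => //; left.
  have [Ur|/existsNP[s1 /not_implyP[rs1 /negP/negPn/eqP Us1]]] :=
    pselect (forall s, reachable Q D0 s -> U s != 0).
    by exists U, M; split => //; left.
  have [s [[sr Us] Hs]] := @tau_escape [set s | reachable Q D0 s /\ U s = 0] s1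
    (conj rs1 Us1) (fun _ => @proj1 _ _).
  have UP t : 0 <= U t by have /andP[] := U0 t.
  have M0 : 0 <= M by have /andP[] := U0 s; exact: le_trans.
  have ExM E : (Ex E (fun u => (U u)%:E) \is a fin_num)%E.
    have EM : (Ex E (fun u => (U u)%:E) <= M%:E)%E.
      by apply: Ex_le => [||t _]; rewrite ?lee_fin//; have /andP[] := U0 t.
    rewrite ge0_fin_numE ?Ex_ge0//; exact: le_lt_trans EM (ltry _).
  have /finite_seqP[Es HEs] : finite_set ([set E | exists a, trans Q s a E] : set (sdT R S)).
    exact: finT.
  have [A A1 HA] := large_multiple (fun E : sdT R S => fine (Ex E (fun u => (U u)%:E))) Es.
  have A0 : 0 <= A by exact: le_trans A1.
  (* The new state gets potential one, so its steps must reach an average of two: this is what [A]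
     was chosen for. Elsewhere scaling by [A], at least one, preserves growth by one. *)
  pose U' t := if t == s then 1 else A * U t.
  have U'P t : 0 <= U' t by rewrite /U'; case: ifP => // _; rewrite mulr_ge0.
  have AU' E : (A%:E * Ex E (fun u => (U u)%:E) <= Ex E (fun u => (U' u)%:E))%E.
    rewrite -Ex_scalel//; apply: le_Ex => t; rewrite lee_fin ?mulr_ge0// => _.
    by rewrite /U'; case: eqP => // ->; rewrite Us mulr0.
  exists U', (A * M + 1); split.
  - move=> t; rewrite U'P /= /U'; case: ifP => _.
      by rewrite lerDr mulr_ge0.
    by apply: ler_wpDr => //; rewrite ler_wpM2l//; have /andP[] := U0 t.
  - move=> t; rewrite /U'; case: ifP => _; first by right.
    have [->|Ut] := U1 t; [by left; rewrite mulr0|right].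
    by rewrite -[1]mulr1 ler_pM.
  - move=> t E tr U't tE; have [ts|ts] := eqVneq t s.
      rewrite {1}/U' ts eqxx; move: tr tE; rewrite ts => tr tE.
      apply: le_trans (AU' E).
      rewrite -[X in (_ <= _ * X)%E]fineK//= -EFinM lee_fin.
      apply: (@le_trans _ _ 2); first by lra.
      apply: HA.
        have aE : exists a, trans Q s a E by exists None.
        have : [set` Es] (E : sdT R S) by rewrite -HEs.
        rewrite /=; elim: (Es) => //= F l' IH; rewrite inE => /orP[/eqP ->|/IH ?].
          by left.
        by right.
      have [u [Eu /not_andP uX]] := Hs E tE.
      have ur : reachable Q D0 u by exact: reachable_step tr tE Eu.
      rewrite -lte_fin fineK// lt_neqAle Ex_ge0 andbT eq_sym.
      apply/eqP => /Ex_supp /(_ Eu) /= [Uu].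
      by case: uX.
    move: U't; rewrite {1 2}/U' (negbTE ts) => U't; apply: le_trans (AU' E).
    have Ut : U t != 0 by apply: contraNneq U't => ->; rewrite mulr0.
    apply: (@le_trans _ _ (A%:E * ((U t)%:E + 1))%E).
      by rewrite -EFinM lee_fin mulrDr mulr1 lerD2l.
    by rewrite lee_wpmul2l ?lee_fin//; exact: HU.
  - right; exists (s :: l); split => /=.
    + rewrite lu andbT; apply/negP => /lr[_]; by rewrite Us eqxx.
    + by rewrite ln.
    + move=> t; rewrite inE /U' => /orP[/eqP ->|/lr[tr Ut]].
        by rewrite eqxx oner_eq0.
      split => //; case: ifP => _; first by rewrite oner_eq0.
      by rewrite mulf_neq0// gt_eqF// (lt_le_trans ltr01).
(* One stage beyond the number of reachable states, only the first alternative is possible. *)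
have [U [M [U0 _ HU [Ur|[l [lu ln lr]]]]]] := HP (size rs).+1.
  by exists U, M; split => // s E sr; apply: HU => //; exact: Ur.
have : (size l <= size rs)%N.
  apply: uniq_leq_size => // s /lr[sr _].
  by have : [set` rs] s by rewrite -Hrs.
by rewrite ln ltnn.
Qed.

Definition reachable_full (D : subdist R S) :=
  full D /\ forall s, D s != 0 -> reachable Q D0 s.

Lemma derivation_reach N D D' : derivation Q N D D' ->
  (forall s, D s != 0 -> reachable Q D0 s) ->
  forall k m, N k m != 0 -> reachable Q D0 m.1.
Proof.
move=> [NI NS NT _] Dr; elim=> [|k IH] m Nm.
  by apply: Dr; rewrite -NI; apply/supp_push; exists m.
have : dpush fst (N k.+1) m.1 != 0 by apply/supp_push; exists m.
rewrite NS => /supp_mix[[s [E|]] Nk /= Em]; last by rewrite eqxx in Em.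
exact: reachable_step (IH _ Nk) (NT _ _ _ Nk) Em.
Qed.

(** If the mass [m] of [D'] were below one, at least [1 - m] would still be moving at every step and
    would raise the potential by that much each time, although the potential is bounded. *)
Lemma derivation_reachable_full N D D' : derivation Q N D D' ->
  reachable_full D -> reachable_full D'.
Proof.
move=> HN [Dfull Dr]; have Nr := derivation_reach HN Dr; have [NI NS NT NF] := HN.
split; last first.
  move=> s /supp_neq0; rewrite NF; last by move=> *; rewrite lee_fin ler0n.
  move=> /esum_neq0[k /Ex_neq0[[t [E|]] Nt /=]]; first by rewrite eqxx.
  by case: (eqVneq t s) => [<- _|_ /eqP//]; exact: Nr Nt.
have [U [M [U0 HU]]] := potential.
have UP t : 0 <= U t by have /andP[] := U0 t.
pose none (m : S * option (sdT R S)) : \bar R := if m.2 is None then 1%E else 0%E.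
pose some (m : S * option (sdT R S)) : \bar R := if m.2 is None then 0%E else 1%E.
pose someU (m : S * option (sdT R S)) : \bar R := if m.2 is None then 0%E else (U m.1)%:E.
have none0 m : (0 <= none m)%E by rewrite /none; case: m.2.
have some0 m : (0 <= some m)%E by rewrite /some; case: m.2.
have someU0 m : (0 <= someU m)%E by rewrite /someU; case: m.2 => //= _; rewrite lee_fin.
have [s0 Ds0] := full_supp Dfull.
have M0 : 0 <= M by have /andP[] := U0 s0; exact: le_trans.
have none1 m : (none m <= 1)%E by rewrite /none; case: m.2.
have some1 m : (some m <= 1)%E by rewrite /some; case: m.2.
have someU1 m : (someU m <= M%:E)%E.
  by rewrite /someU; case: m.2 => [_|]; rewrite lee_fin//; have /andP[] := U0 m.1.
have fin f c k : (forall m, 0 <= f m)%E -> (forall m, f m <= c%:E)%E -> 0 <= c ->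
    (Ex (N k) f \is a fin_num)%E.
  move=> f0 fc c0; have E1 : (Ex (N k) f <= c%:E)%E by exact: Ex_le.
  rewrite ge0_fin_numE ?Ex_ge0//; exact: le_lt_trans E1 (ltry _).
(* At step [k]: [x k] is the mass that stops, [g k] the mass that moves on, and [u k] the potential
   carried by the latter. *)
have [x xE] : exists x : nat -> R, forall k, (x k)%:E = Ex (N k) none.
  by exists (fun k => fine (Ex (N k) none)) => k; rewrite fineK//; exact: fin.
have [g gE] : exists g : nat -> R, forall k, (g k)%:E = Ex (N k) some.
  by exists (fun k => fine (Ex (N k) some)) => k; rewrite fineK//; exact: fin.
have [u uE] : exists u : nat -> R, forall k, (u k)%:E = Ex (N k) someU.
  by exists (fun k => fine (Ex (N k) someU)) => k; rewrite fineK//; exact: fin.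
have massE k : (Ex (dpush fst (N k)) (fun=> 1) = (x k + g k)%:E)%E.
  rewrite EFinD xE gE Ex_push -Ex_add//; apply: eq_Ex => -[s [E|]] _ /=;
  by rewrite /none /some /= ?adde0 ?add0e.
have x0g0 : x 0%N + g 0%N = 1.
  by apply: EFin_inj; rewrite -massE NI Ex_full.
have gS k : g k = x k.+1 + g k.+1.
  apply: EFin_inj; rewrite -massE NS Ex_mix gE; apply: eq_Ex => -[s [E|]] Ns.
    by rewrite /some /= Ex_full//; exact: trans_full (NT _ _ _ Ns).
  by rewrite /some /= Ex_zero.
have uM k : u k <= M * g k.
  rewrite -lee_fin EFinM gE uE.
  rewrite (_ : Ex (N k) some = Ex (N k) (fun m => (fine (some m))%:E)); last first.
    by apply: eq_Ex => m _; rewrite /some; case: m.2.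
  rewrite -Ex_scalel//; last by move=> m; rewrite /some; case: m.2.
  apply: le_Ex => // m _; rewrite /someU /some; case: m.2 => [_|].
    by rewrite /= mulr1 lee_fin; have /andP[] := U0 m.1.
  by rewrite /= mulr0.
have uS k : g k + u k <= M * x k.+1 + u k.+1.
  rewrite -lee_fin !EFinD EFinM gE uE uE.
  apply: (@le_trans _ _ (Ex (dpush fst (N k.+1)) (fun u => (U u)%:E))).
    rewrite NS Ex_mix -Ex_add//; apply: le_Ex => [m|[s [E|]] Ns].
      by rewrite adde_ge0.
    - rewrite /some /someU /= addeC; apply: HU; last exact: NT Ns.
      exact: Nr Ns.
    - by rewrite /some /someU /= adde0.
  rewrite Ex_push xE.
  rewrite (_ : Ex (N k.+1) none = Ex (N k.+1) (fun m => (fine (none m))%:E)); last first.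
    by apply: eq_Ex => m _; rewrite /none; case: m.2.
  rewrite -Ex_scalel//; last by move=> m; rewrite /none; case: m.2.
  rewrite -Ex_add//; last first.
    by move=> m; rewrite lee_fin mulr_ge0// /none; case: m.2.
  apply: le_Ex => [m|[s [E|]] _]; rewrite ?lee_fin//=.
  - by rewrite /none /someU /= mulr0 add0r.
  - by rewrite /none /someU /= mulr1 addr0; have /andP[] := U0 s.
have [m mE] : exists m : R, m%:E = Ex D' (fun=> 1%E).
  exists (fine (Ex D' (fun=> 1%E))); rewrite fineK// ge0_fin_numE ?Ex_ge0//.
  exact: le_lt_trans (Ex1_le1 D') (ltry _).
have gm n : 1 - m <= g n.
  have S1 : \sum_(k < n.+1) x k + g n = 1.
    elim: n => [|n IH]; first by rewrite big_ord1.
    by rewrite big_ord_recr /= -addrA -gS.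
  have : \sum_(k < n.+1) x k <= m.
    rewrite -lee_fin mE NF// -sumEFin; under eq_bigr do rewrite xE.
    by apply: esum_nat_ge => k; exact: Ex_ge0.
  by rewrite -S1 => ?; lra.
(* Subtracting [M * g n] compensates for potential lost with stopping mass, at most [M] per unit.
   The difference then rises by [g n] at each step, but by [uM] it is never positive. *)
have phi n : - M + (1 - m) *+ n <= u n - M * g n.
  elim: n => [|n IH].
    have u0 : 0 <= u 0%N by rewrite -lee_fin uE Ex_ge0.
    have x0 : 0 <= x 0%N by rewrite -lee_fin xE Ex_ge0.
    have : M * g 0%N <= M * 1 by rewrite ler_wpM2l// -x0g0 lerDr.
    by rewrite mulr0n mulr1 => ?; lra.
  have := uS n; have := gm n; have -> : M * g n.+1 = M * g n - M * x n.+1.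
    by rewrite (gS n) mulrDr addrAC subrr add0r.
  by rewrite mulrSr => ? ?; lra.
have le0 n : (1 - m) *+ n <= M.
  rewrite -(lerD2l (- M)) addNr; apply: (le_trans (phi n)).
  by rewrite subr_le0.
apply/fullE/eqP; rewrite eq_le Ex1_le1/= -mE lee_fin leNgt; apply/negP => m1.
have d0 : 0 < 1 - m by rewrite subr_gt0.
have := le0 (Num.truncn (M / (1 - m))).+1.
rewrite leNgt => /negP; apply; rewrite -mulr_natl -ltr_pdivrMr//.
exact: truncnS_gt.
Qed.

End Convergence.

(** * Contraction of silent moves *)

Section Elimination.
Context {R : realType} {C Omega pos : choiceType}.
Variables (CC : plts R C Omega) (f : pos -> C) (stp : C -> pos).
Variables (raw : pos -> subdist R pos) (rk : pos -> nat).
Hypothesis stpK : cancel stp f.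
Hypothesis succ_stable : forall c w E c', enables CC c (Some w) ->
  trans CC c None E -> E c' != 0 -> enables CC c' (Some w).

(* Moves of [raw] that leave [f x] unchanged are not moves of a resolution; they
   are contracted by [sclosure], which terminates because [rk] decreases along
   them. Where [raw] is no legitimate move an arbitrary scheduler takes over, so
   that no invariant on the positions has to be maintained. *)
Definition observable x : bool := `[< trans CC (f x) None (dpush f (raw x)) >].

Definition silent x : bool := ~~ observable x && `[< full (raw x) /\
  forall y, raw x y != 0 -> f y = f x /\ (rk y < rk x)%N >].

(** The arbitrary scheduler: it moves in [CC] and continues from the positions that [stp] assigns to
    bare states. *)
Definition fallback x : option (subdist R pos) := omap (dpush stp) (tau_next CC (f x)).

Definition vnext x : option (subdist R pos) :=
  if observable x || silent x then Some (raw x) else fallback x.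

Definition vsucc x (w : Omega) : bool := succeeds CC (f x) w.

Lemma fallback_trans x mu : fallback x = Some mu -> trans CC (f x) None (dpush f mu).
Proof.
rewrite /fallback; case E : (tau_next CC (f x)) => [nu|//] /= [<-].
rewrite push_push (_ : dpush _ nu = nu); first exact: tau_next_trans.
by apply: sd_eqEx => h _; rewrite Ex_push; apply: eq_Ex => c _ /=; rewrite stpK.
Qed.

Lemma vnext_persistent : persistent vsucc vnext.
Proof.
have H x mu : trans CC (f x) None (dpush f mu) -> full mu /\
    forall y w, mu y != 0 -> vsucc x w -> vsucc y w.
  move=> t; split; first by have := trans_full t; rewrite full_push.
  move=> y w muy /asboolP sx; apply/asboolP; apply: succ_stable sx t _.
  by apply/supp_push; exists y.
move=> x mu; rewrite /vnext; case: ifP => [|_ /fallback_trans/H//].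
case/orP => [/asboolP/H tx [<-]//|/andP[_ /asboolP[fx Hx]] [<-]].
by split => // y w /Hx[yx _]; rewrite /vsucc yx.
Qed.

Fixpoint sclosure_at n x : subdist R pos :=
  if silent x then
    if n is n'.+1 then dmix (raw x) (sclosure_at n') else dpoint x
  else dpoint x.

Definition sclosure x := sclosure_at (rk x) x.

Lemma silentP x : silent x -> full (raw x) /\
  forall y, raw x y != 0 -> f y = f x /\ (rk y < rk x)%N.
Proof. by case/andP => _ /asboolP. Qed.

Lemma silent_rk x : silent x -> (0 < rk x)%N.
Proof. by move=> /silentP[/full_supp[y xy] H]; apply: leq_ltn_trans (H y xy).2. Qed.

(** A silent position has positive rank and its successors have smaller rank, so fuel equal to the
    rank never runs out early. *)
Lemma closure_stable n m x : (rk x <= n)%N -> (rk x <= m)%N ->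
  sclosure_at n x = sclosure_at m x.
Proof.
elim: n m x => [|n IH] m x xn xm.
  case: m xm => //= m _; case: ifP => // sx.
  by have := leq_trans (silent_rk sx) xn.
case: m xm => [|m] xm /=; case: ifP => // sx.
  by have := leq_trans (silent_rk sx) xm.
apply: eq_mix => y xy; have [_ yx] := (silentP sx).2 y xy.
by apply: IH; rewrite -ltnS; exact: leq_trans yx _.
Qed.

Lemma closure_silent x : silent x -> sclosure x = dmix (raw x) sclosure.
Proof.
move=> sx; have := silent_rk sx; rewrite /sclosure; case E : (rk x) => [//|n] _ /=.
rewrite sx; apply: eq_mix => y xy; have [_ yx] := (silentP sx).2 y xy.
by apply: closure_stable; rewrite // -ltnS -E.
Qed.

Lemma closure_visible x : ~~ silent x -> sclosure x = dpoint x.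
Proof. by rewrite /sclosure => /negbTE sx; case: (rk x) => /= [|n]; rewrite sx. Qed.

Lemma rk_ind (P : pos -> Prop) :
  (forall x, ~~ silent x -> P x) ->
  (forall x, silent x -> (forall y, raw x y != 0 -> P y) -> P x) -> forall x, P x.
Proof.
move=> H0 H1 x; have [n xn] : exists n, (rk x <= n)%N by exists (rk x).
elim: n x xn => [|n IH] x xn; have [sx|/H0//] := boolP (silent x).
  by have := leq_trans (silent_rk sx) xn.
apply: H1 => // y xy; apply: IH; rewrite -ltnS.
by apply: leq_trans xn; have [] := (silentP sx).2 y xy.
Qed.

Lemma closure_full x : full (sclosure x).
Proof.
elim/rk_ind: x => x sx; first by rewrite closure_visible//; exact: full_point.
by move=> IH; rewrite closure_silent//; apply: full_mix => //; have [] := silentP sx.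
Qed.

Lemma closure_supp x y : sclosure x y != 0 -> f y = f x /\ ~~ silent y.
Proof.
move: y; elim/rk_ind: x => x sx.
  by move=> y; rewrite closure_visible// => /supp_point ->.
move=> IH y; rewrite closure_silent// => /supp_mix[z xz zy].
by have [<-] := (silentP sx).2 z xz; move=> _; exact: IH.
Qed.

Lemma closure_push x : dpush f (sclosure x) = dpoint (f x).
Proof.
apply: sd_eqEx => h h0; rewrite Ex_push Ex_point//.
rewrite (eq_Ex (g := fun=> h (f x))) ?Ex_cst//; first exact: closure_full.
by move=> y /closure_supp[/= -> _].
Qed.

Definition cnext x : option (subdist R pos) :=
  omap (fun mu => dmix mu sclosure) (if observable x then Some (raw x) else fallback x).

Lemma cnext_trans x mu : cnext x = Some mu -> trans CC (f x) None (dpush f mu).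
Proof.
have X nu : dpush f (dmix nu sclosure) = dpush f nu.
  by rewrite push_mix -(mix_dpoint nu f); apply: eq_mix => y _; exact: closure_push.
rewrite /cnext; case: ifP => [/asboolP t [<-]|_]; first by rewrite X.
case E : (fallback x) => [nu|//] /= [<-]; rewrite X; exact: fallback_trans.
Qed.

(** The target of a success move does not affect the value; fixing one by choice keeps the system
    deterministic. *)
Definition ctrans x (a : option Omega) mu : Prop :=
  if a is Some w then
    exists2 h : enables CC (f x) (Some w), True & mu = dpush stp (projT1 (cid h))
  else cnext x = Some mu.

Lemma ctrans_full x a mu : ctrans x a mu -> full mu.
Proof.
case: a => [w [h _ ->]|/cnext_trans/trans_full] /=; last by rewrite full_push.
by rewrite full_push; case: cid => E /= /trans_full.
Qed.

Definition cplts : plts R pos Omega := PLTS ctrans_full.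

Lemma cplts_det : deterministic cplts.
Proof.
move=> x [w|] E E' /=; last by move=> -> [].
by move=> [h _ ->] [h' _ ->]; rewrite (Prop_irrelevance h h').
Qed.

Lemma cnext_None x : enables CC (f x) None -> cnext x <> None.
Proof.
move=> en; rewrite /cnext /fallback; case: ifP => // _.
by case E : (tau_next CC (f x)) => [//|]; have := tau_next_None E.
Qed.

Lemma cplts_succ x w : succeeds cplts x w = vsucc x w.
Proof.
apply/asbool_equiv_eq; split => [[E [h _ _]]//|h].
by exists (dpush stp (projT1 (cid h))), h.
Qed.

Lemma cplts_next x : tau_next cplts x = cnext x.
Proof.
case E : (cnext x) => [mu|]; first exact: tau_next_det cplts_det _.
case E' : (tau_next cplts x) => [mu|//].
by have := tau_next_trans E'; rewrite /= E.
Qed.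

Lemma cplts_resolution lam : resolution CC (dpush f lam) cplts (dmix lam sclosure) f.
Proof.
split; first exact: cplts_det.
- by rewrite push_mix -(mix_dpoint lam f); apply: eq_mix => y _; exact: closure_push.
- move=> x [w|] E /=; last exact: cnext_trans.
  move=> [h _ ->]; rewrite push_push (_ : dpush _ _ = projT1 (cid h)).
    by case: cid.
  by apply: sd_eqEx => g _; rewrite Ex_push; apply: eq_Ex => c _ /=; rewrite stpK.
- move=> x [w|] en; first by exists (dpush stp (projT1 (cid en))), en.
  by case E : (cnext x) (cnext_None en) => [mu|//] _; exists mu.
Qed.

Let V := lval (R := R) vsucc vnext.
Let V' := lval (R := R) (succeeds cplts) (tau_next cplts).

(** Silent moves only redistribute: by persistence the value of a silent position is the average
    over its successors. *)
Lemma val_closure x w : V x w = Ex (sclosure x) (V ^~ w).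
Proof.
elim/rk_ind: x => x sx; first by rewrite closure_visible// Ex_point//; exact: lval_ge0.
move=> IH; rewrite closure_silent// Ex_mix [LHS](lval_step vnext_persistent (mu := raw x)).
  by apply: eq_Ex => y /IH.
by rewrite /vnext sx orbT.
Qed.

Lemma cnextE x : ~~ silent x -> cnext x = omap (fun mu => dmix mu sclosure) (vnext x).
Proof. by rewrite /cnext /vnext => /negbTE ->; rewrite orbF; case: ifP. Qed.

(** A contracted move is one move of [vnext] followed by silent moves, and the latter keep the
    average of [V]. *)
Lemma val_le_closure n x w : ~~ silent x ->
  (itv (succeeds cplts) (tau_next cplts) n x w <= V x w)%E.
Proof.
elim: n x => [|n IH] x sx /=; rewrite cplts_succ; case: ifP => svx.
- by rewrite /V lval_succ.
- exact: lval_ge0.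
- by rewrite /V lval_succ.
rewrite cplts_next cnextE// /V lval_fix svx; case: (vnext x) => //= mu.
rewrite Ex_mix; apply: le_Ex => [y|y _]; first exact: Ex_ge0.
rewrite -/V val_closure; apply: le_Ex => // z /closure_supp[_]; exact: IH.
Qed.

(** A silent move uses up one iterate on the left and leaves the right side as it is; any other move
    unfolds both sides once. *)
Lemma closure_ge_val m x w :
  (itv vsucc vnext m x w <= Ex (sclosure x) (V' ^~ w))%E.
Proof.
have V'1 y : vsucc y w -> V' y w = 1%E by move=> sy; rewrite /V' lval_succ// cplts_succ.
have [sx|sx] := boolP (vsucc x w).
  rewrite itv_succ// (eq_Ex (g := fun=> 1%E)) ?Ex_cst//; first exact: closure_full.
  by move=> y /closure_supp[yx _]; apply: V'1; rewrite /vsucc yx.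
elim: m x sx => [|m IHm] x sx; first by rewrite /= (negbTE sx).
have IH y : (itv vsucc vnext m y w <= Ex (sclosure y) (V' ^~ w))%E.
  have [sy|/IHm//] := boolP (vsucc y w).
  rewrite itv_succ// (eq_Ex (g := fun=> 1%E)) ?Ex_cst//; first exact: closure_full.
  by move=> z /closure_supp[yx _]; apply: V'1; rewrite /vsucc yx.
rewrite /= (negbTE sx); have [six|six] := boolP (silent x).
  rewrite {1}/vnext six orbT closure_silent// Ex_mix.
  by apply: le_Ex => // y _; exact: IH.
rewrite closure_visible// Ex_point; last exact: lval_ge0.
rewrite /V' lval_fix -/V' cplts_succ (negbTE sx) cplts_next cnextE//.
case: (vnext x) => //= mu; rewrite Ex_mix.
by apply: le_Ex => // y _; exact: IH.
Qed.

Lemma closure_val x w : V x w = Ex (sclosure x) (V' ^~ w).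
Proof.
apply/eqP; rewrite eq_le; apply/andP; split.
  by apply: ge_ereal_sup => _ [n _ <-]; exact: closure_ge_val.
rewrite val_closure; apply: le_Ex => [y|y /closure_supp[_ sy]]; first exact: lval_ge0.
by apply: ge_ereal_sup => _ [n _ <-]; exact: val_le_closure.
Qed.

Lemma elimination lam (o : Omega -> R) :
  (forall w, (o w)%:E = Ex lam (V ^~ w)) -> outcomes CC (dpush f lam) o.
Proof.
move=> Ho; exists pos, cplts, (dmix lam sclosure), f, (fun r w => fine (V' r w)).
have HV : value cplts (fun r w => fine (V' r w)) by exact: value_fine.
split => //; first exact: cplts_resolution.
apply/funext => w; apply: EFin_inj; rewrite (expect_value _ _ HV) Ho Ex_mix.
by apply: eq_Ex => x _; rewrite closure_val.
Qed.

End Elimination.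

(** * Runs of the simulated process *)

Section ParFacts.
Context {R : realType} {Act : Type} {Omega T P : choiceType}.
Variables (TT : plts R T (Act + Omega)) (PP : plts R P Act).
Hypothesis test : test_conditions TT.

Definition tsucc (t : T) (w : Omega) : bool := `[< enables TT t (Some (inr w)) >].

Lemma par_transP x D : trans (par TT PP) x None D ->
  [\/ exists2 Th, trans TT x.1 None Th & D = dprod Th (dpoint x.2),
      exists2 D', trans PP x.2 None D' & D = dprod (dpoint x.1) D' |
      exists a Th D', [/\ trans TT x.1 (Some (inl a)) Th, trans PP x.2 (Some a) D' &
        D = dprod Th D'] ].
Proof.
rewrite /=; move E : None => l H; case: H E => // {x l D}.
- by move=> t p Th tTh _; apply: Or31; exists Th.
- by move=> t p D' pD _; apply: Or32; exists D'.
- by move=> t p a Th D' tTh pD _; apply: Or33; exists a, Th, D'.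
Qed.

Lemma par_succ x w : enables (par TT PP) x (Some w) <-> enables TT x.1 (Some (inr w)).
Proof.
split=> [[D /=]|]; last first.
  by case: x => t p [Th tTh]; exists (dprod Th (dpoint p)); exact: par_success.
move E : (Some w) => l H; case: H E => // {x l D} t p w' Th tTh [->]; by exists Th.
Qed.

(** Moves in which the test takes part keep success by condition (B); moves of the process alone do
    not change the test state. *)
Lemma par_stable x w D y : enables (par TT PP) x (Some w) ->
  trans (par TT PP) x None D -> D y != 0 -> enables (par TT PP) y (Some w).
Proof.
rewrite !par_succ => xw /par_transP; have [_ B] := test.
case=> [[Th tTh ->]|[D' _ ->]|[a [Th [D' [tTh _ ->]]]]] /supp_prod[y1 y2].
- exact: (B _ w None Th xw tTh _ y1).
- by move/supp_point: y1 => ->.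
- exact: (B _ w (Some a) Th xw tTh _ y1).
Qed.

Lemma par_succeeds x w : succeeds (par TT PP) x w = tsucc x.1 w.
Proof. by apply/asbool_equiv_eq; exact: par_succ. Qed.

End ParFacts.

Section ProcessRun.
Context {R : realType} {Act : Type} {Omega T P Q : choiceType}.
Variables (TT : plts R T (Act + Omega)) (PP : plts R P Act).
Variables (QQ : plts R Q Omega) (f0 : Q -> T * P).
Hypothesis test : test_conditions TT.
Hypothesis det : deterministic QQ.
Hypothesis Qtrans : forall r a E, trans QQ r a E -> trans (par TT PP) (f0 r) a (dpush f0 E).
Hypothesis Qenables : forall r a, enables (par TT PP) (f0 r) a -> enables QQ r a.

Local Notation kG := (tau_next QQ).
Local Notation sG := (succeeds QQ).

Lemma succ_res r w : sG r w = tsucc TT (f0 r).1 w.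
Proof.
rewrite -(par_succeeds TT PP); apply/asbool_equiv_eq; split; last exact: Qenables.
by move=> [E /Qtrans tE]; exists (dpush f0 E).
Qed.

Lemma res_persistent : persistent sG kG.
Proof.
move=> r mu /tau_next_trans tmu; split; first exact: trans_full tmu.
move=> r' w mur'; rewrite !succ_res -!(par_succeeds TT PP) => /asboolP sr; apply/asboolP.
by apply: (par_stable test sr (Qtrans tmu)); apply/supp_push; exists r'.
Qed.

Definition process_move (r : Q) : bool := `[< exists2 E, kG r = Some E &
  exists2 D, trans PP (f0 r).2 None D & dpush f0 E = dprod (dpoint (f0 r).1) D >].

Definition res_kernel (r : Q) : subdist R Q := odflt (dzero Q) (kG r).

Variable r0 : Q.

(** Only process moves are followed; mass whose next move is of another kind leaves the run and is
    collected in [halted]. *)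
Fixpoint run (k : nat) : subdist R Q :=
  if k is k'.+1 then dmix (drestrict (run k') process_move) res_kernel else dpoint r0.

Definition halted k := drestrict (run k) (predC process_move).

Lemma run_test k r : run k r != 0 -> (f0 r).1 = (f0 r0).1.
Proof.
elim: k r => [|k IH] r; first by move=> /supp_point ->.
rewrite -[run k.+1]/(dmix (drestrict (run k) process_move) res_kernel).
case/supp_mix => r'; rewrite restrictE; case: ifP; last by rewrite eqxx.
move=> /asboolP[E kE [D _ fE]] /IH <-; rewrite /res_kernel kE => Er.
have : dpush f0 E (f0 r) != 0 by apply/supp_push; exists r.
by rewrite fE => /supp_prod[/supp_point].
Qed.

Lemma run_go k (f : nat -> Q -> \bar R) m : (forall r, 0 <= f m.+1 r)%E ->
  (forall r mu, kG r = Some mu -> f m.+1 r = Ex mu (f m)) ->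
  Ex (run k) (f m.+1) = (Ex (halted k) (f m.+1) + Ex (run k.+1) (f m))%E.
Proof.
move=> f0' fstep; rewrite addeC (Ex_split _ process_move f0') /= Ex_mix.
congr (_ + _)%E; apply: eq_Ex => r; rewrite restrictE; case: ifP; last by rewrite eqxx.
by move=> /asboolP[E kE _] _; rewrite /res_kernel kE; exact: fstep.
Qed.

Lemma halted_mass : (\esum_(k in [set: nat]) Ex (halted k) (fun=> 1) <= 1)%E.
Proof.
apply: le_trans (Ex1_le1 (run 0%N)).
apply: (telescope_ge (a := fun k => Ex (run k) (fun=> 1%E))) => k; rewrite ?Ex_ge0//.
rewrite addeC [leRHS](Ex_split _ process_move (fun=> lee01)); apply: leeD => //.
by rewrite /= Ex_mix; apply: le_Ex => // r _; exact: Ex1_le1.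
Qed.

(** The halted parts form a weak derivation of the process. Mass that runs for ever is lost, but the
    test state never changes along it, so under an unsuccessful test it adds nothing to any iterate.
    Under a successful test it would, hence the hypothesis of the last bound. *)
Lemma process_run : exists B : subdist R Q,
  [/\ wtau PP (dpoint (f0 r0).2) (dpush (snd \o f0) B),
      forall r, B r != 0 -> ~~ process_move r /\ (f0 r).1 = (f0 r0).1,
      forall w, (Ex B (lval sG kG ^~ w) <= lval sG kG r0 w)%E &
      forall n w, ~~ sG r0 w -> (itv sG kG n r0 w <= Ex B (itv sG kG n ^~ w))%E].
Proof.
have [B HB] := series_ex halted_mass; exists B.
have BE f : Ex B f = (\esum_(k in [set: nat]) Ex (halted k) f)%E by exact: Ex_series.
have pers := res_persistent.
split.
- exists (fun k => dpush (snd \o f0) (drestrict (run k) process_move)).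
  exists (fun k => dpush (snd \o f0) (halted k)).
  have split_push k s : dpush (snd \o f0) (run k) s =
      dpush (snd \o f0) (drestrict (run k) process_move) s + dpush (snd \o f0) (halted k) s.
    apply: EFin_inj; rewrite EFinD -!Ex_ind !Ex_push; apply: Ex_split => r.
    by rewrite lee_fin ler0n.
  split.
  + by move=> s; rewrite -split_push -[run 0%N]/(dpoint r0) push_point.
  + move=> k; exists (dpush (snd \o f0) (run k.+1)); last exact: split_push.
    rewrite /= push_mix -mix_dpoint; apply: lift_mix_supp => r.
    rewrite restrictE; case: ifP; last by rewrite eqxx.
    move=> /asboolP[E kE [D pD fE]] _; rewrite /res_kernel kE /= -push_push fE.
    rewrite (_ : dpush snd _ = D); first exact: lift_point.
    by apply: sd_eqEx => f f0'; rewrite Ex_push Ex_prod Ex_point.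
  + move=> s; rewrite -Ex_ind Ex_push BE; apply: eq_esum => k _.
    by rewrite -Ex_ind Ex_push.
- move=> r; rewrite -eqe HB => /esum_neq0[k]; rewrite eqe /halted restrictE /=.
  by case: (process_move r) => /=; rewrite ?eqxx//; move=> /run_test.
- move=> w; rewrite BE.
  have -> : lval sG kG r0 w = Ex (run 0%N) (lval sG kG ^~ w).
    by rewrite [RHS]Ex_point// lval_ge0.
  apply: (telescope_ge (a := fun k => Ex (run k) (lval sG kG ^~ w))) => k; rewrite ?Ex_ge0//.
  rewrite (run_go (f := fun _ r => lval sG kG r w) (m := 0%N) k)//.
  by move=> r mu; exact: (lval_step pers).
move=> n w sr0; rewrite BE.
have -> : itv sG kG n r0 w = Ex (run 0%N) (itv sG kG n ^~ w).
  by rewrite [RHS]Ex_point// itv_ge0.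
(* The fuel is the index of the iterate. At index zero only success counts, and the unchanged test
   state excludes it. *)
apply: (telescope_le (a := fun m k => Ex (run k) (itv sG kG m ^~ w))
  (b := fun m k => Ex (halted k) (itv sG kG m.+1 ^~ w))) => [k|k|m k|j k jn].
- exact: Ex_ge0.
- apply: Ex_eq0 => r /run_test tr /=.
  by rewrite succ_res tr -succ_res (negbTE sr0).
- rewrite (run_go k (f := fun m r => itv sG kG m r w))//.
  by move=> r mu; exact: (itv_step pers).
- apply: le_Ex => r; first exact: itv_ge0.
  move=> _; rewrite -(subnK jn); elim: (n - _)%N => [//|d IHd].
  exact: le_trans IHd (itv_mono _ _ _ _ _).
Qed.

End ProcessRun.

(** * Matching *)

Section Matching.
Context {R : realType} {P : choiceType} {L : Type}.
Variables (PP : plts R P L) (D0 : subdist R P).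
Hypotheses (finD : finitary PP D0) (convD : convergent PP D0).

(** Fullness and reachability travel with the simulation, so that the answers to later moves keep
    their mass as well. *)
Definition simulated (p : P) (E : subdist R P) : Prop := fsim PP p E /\ reachable_full PP D0 E.

Lemma lift_mono (X Y : P -> subdist R P -> Prop) G E :
  (forall p F, X p F -> Y p F) -> lift X G E -> lift Y G E.
Proof.
move=> XY; elim=> [s F /XY XsF|I w A B _ IH]; first exact: lift_point.
exact: lift_mix.
Qed.

(** Each answer has mass at most one and the average mass is one, so the defect vanishes on the
    support of [W]. *)
Lemma coupling_mass X G (E : subdist R P) W : coupling X G E W -> full E ->
  forall x, W x != 0 -> full (sdv x.2).
Proof.
move=> [_ _ WE] /fullE E1 x Wx; apply/fullE.
have X1 y : (Ex (sdv (y : P * sdT R P).2) (fun=> 1) <= 1)%E by exact: Ex1_le1.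
have Xf y : (Ex (sdv (y : P * sdT R P).2) (fun=> 1%E) \is a fin_num)%E.
  rewrite ge0_fin_numE ?Ex_ge0//; exact: le_lt_trans (X1 y) (ltry _).
have X0 y : (0 <= 1 - Ex (sdv (y : P * sdT R P).2) (fun=> 1))%E.
  by rewrite sube_ge0// Xf.
have H : (Ex W (fun y => 1 - Ex (sdv y.2) (fun=> 1)) + 1 <= 1)%E.
  rewrite -[X in (_ + X <= _)%E]E1 -WE Ex_mix -Ex_add//.
  rewrite (eq_Ex (g := fun=> 1%E)) ?Ex1_le1// => y _.
  by rewrite subeK.
have : Ex W (fun y => 1 - Ex (sdv y.2) (fun=> 1))%E = 0%E.
  apply/eqP; rewrite eq_le Ex_ge0 andbT -(@leeD2rE _ 1%E)//.
  by rewrite add0e.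
move=> /Ex_supp /(_ Wx) /= x0.
by have := subeK 1%E (Xf x); rewrite x0 add0e.
Qed.

Lemma simulated_coupling G E : lift (fsim PP) G E -> reachable_full PP D0 E ->
  exists W, coupling simulated G E W.
Proof.
move=> /lift_coupling[W HW] [fE rE]; exists W; have [W1 W2 W3] := HW.
split => // x Wx; split; first exact: W1.
split; first exact: coupling_mass HW fE x Wx.
move=> s xs; apply: rE; rewrite -W3; apply/supp_mix; by exists x.
Qed.

Lemma action_reachable_full a E E' W : coupling (fun s F => trans PP s a F) E E' W ->
  reachable_full PP D0 E -> reachable_full PP D0 E'.
Proof.
move=> [W1 W2 W3] [fE rE]; split; rewrite -W3.
  apply: full_mix; first by rewrite -W2 in fE; move: fE; rewrite full_push.
  by move=> x /W1; exact: trans_full.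
move=> s /supp_mix[x Wx xs]; apply: reachable_step (W1 x Wx) xs.
by apply: rE; rewrite -W2; apply/supp_push; exists x.
Qed.

Lemma match_tau p E G : simulated p E -> wtau PP (dpoint p) G ->
  exists N E' W, [/\ derivation PP N E E', reachable_full PP D0 E' & coupling simulated G E' W].
Proof.
move=> [[X FX XpE] iE] pG; have [/(_ None G pG)[E' EE' XGE'] _] := FX _ _ XpE.
have [N HN] := wtau_derivation EE'.
have iE' := derivation_reachable_full finD convD HN iE.
have /simulated_coupling/(_ iE')[W HW] : lift (fsim PP) G E'.
  by apply: lift_mono XGE' => q F XqF; exists X.
by exists N, E', W.
Qed.

(** A single action step is a weak one with idle derivations around it. Mass is kept through all
    three stages of the answer. *)
Lemma match_act p E a G : simulated p E -> trans PP p (Some a) G ->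
  exists N E1 Wa E2 N' E3 W, [/\ derivation PP N E E1, reachable_full PP D0 E1,
    coupling (fun s F => trans PP s (Some a) F) E1 E2 Wa,
    derivation PP N' E2 E3 & reachable_full PP D0 E3 /\ coupling simulated G E3 W].
Proof.
move=> [[X FX XpE] iE] pG.
have pw : weak PP (Some a) (dpoint p) G.
  exists (dpoint p), G; split; [exact: wtau_refl|exact: lift_point|exact: wtau_refl].
have [/(_ _ _ pw)[E3 [E1 [E2 [EE1 E12 E23]]] XGE3] _] := FX _ _ XpE.
have [N HN] := wtau_derivation EE1; have [N' HN'] := wtau_derivation E23.
have [Wa HWa] := lift_coupling E12.
have i1 := derivation_reachable_full finD convD HN iE.
have i3 := derivation_reachable_full finD convD HN' (action_reachable_full HWa i1).
have /simulated_coupling/(_ i3)[W HW] : lift (fsim PP) G E3.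
  by apply: lift_mono XGE3 => q F XqF; exists X.
by exists N, E1, Wa, E2, N', E3, W.
Qed.

Lemma match_refuse p E A : simulated p E -> refuses PP A p ->
  exists N E1, [/\ derivation PP N E E1, reachable_full PP D0 E1 & drefuses PP A E1].
Proof.
move=> [[X FX XpE] iE] pA; have [_ /(_ A)[]] := FX _ _ XpE.
  by exists (dpoint p); [exact: wtau_refl|move=> s /supp_point ->].
move=> E1 /wtau_derivation[N HN] E1A; exists N, E1; split => //.
exact: derivation_reachable_full HN iE.
Qed.

Lemma idle_derivation (E : subdist R P) : exists N, derivation PP N E E.
Proof. exact: wtau_derivation (wtau_refl PP E). Qed.

End Matching.

(** * Pairing resolution states with simulating states *)

Section Joint.
Context {R : realType} {T P Q : choiceType}.
Variables (f0 : Q -> T * P) (beta : subdist R Q) (W : subdist R (P * sdT R P)%type).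
Variables (th : subdist R T) (G E : subdist R P) (X : P -> subdist R P -> Prop).

(** The answer is drawn given the process component of [r], so it simulates precisely that
    component. *)
Definition joint : subdist R ((Q * sdT R P) * P)%type :=
  dmix beta (fun r => dmix (dcond W fst (f0 r).2)
    (fun x => dpush (fun q => ((r, x.2), q)) (sdv x.2))).

Lemma Ex_joint f : Ex joint f = Ex beta (fun r => Ex (dcond W fst (f0 r).2)
    (fun x => Ex (sdv x.2) (fun q => f ((r, x.2), q)))).
Proof.
rewrite Ex_mix; apply: eq_Ex => r _; rewrite Ex_mix; apply: eq_Ex => x _.
by rewrite Ex_push.
Qed.

Hypotheses (HW : coupling X G E W) (Hbeta : dpush f0 beta = dprod th G).

(** Under [beta] the process component has law [G] independently of the test component. Averaging
    the conditional laws of [W] over [G] restores [W], whose answers mix to [E]. *)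
Lemma joint_push : dpush (fun x => ((f0 x.1.1).1, x.2)) joint = dprod th E.
Proof.
have [_ WG WE] := HW.
apply: sd_eqEx => f f_ge0; rewrite Ex_push Ex_joint Ex_prod /=.
transitivity (Ex (dpush f0 beta) (fun y => Ex (dcond W fst y.2)
    (fun x => Ex (sdv x.2) (fun q => f (y.1, q))))); first by rewrite Ex_push.
rewrite Hbeta Ex_prod; apply: eq_Ex => t _ /=.
by rewrite -WG Ex_dcond -WE Ex_mix.
Qed.

Lemma joint_le f v : (forall r, 0 <= v r)%E ->
  (forall r F, beta r != 0 -> X (f0 r).2 F -> (Ex F (fun q => f ((r, F : sdT R P), q)) <= v r)%E) ->
  (Ex joint f <= Ex beta v)%E.
Proof.
move=> v0 H; rewrite Ex_joint; apply: le_Ex => // r br; apply: Ex_le => // x Wx.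
by apply: H => //; have [<- Wy0] := supp_dcond Wx; have [H' _ _] := HW; exact: H'.
Qed.

(** Unlike the upper bound, this one needs the conditional law to be full: the process component of
    a drawn [r] has positive mass under [G]. *)
Lemma joint_ge f v : (forall r, 0 <= v r)%E ->
  (forall r F, beta r != 0 -> X (f0 r).2 F -> (v r <= Ex F (fun q => f ((r, F : sdT R P), q)))%E) ->
  (Ex beta v <= Ex joint f)%E.
Proof.
move=> v0 H; rewrite Ex_joint; have [H' WG _] := HW; apply: le_Ex => // r br.
have fW : full (dcond W fst (f0 r).2).
  apply: dcond_full; rewrite WG.
  have : dpush f0 beta (f0 r) != 0 by apply/supp_push; exists r.
  by rewrite Hbeta => /supp_prod[].
rewrite -[leLHS](Ex_cst fW)//; apply: le_Ex => // x Wx.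
by apply: H => //; have [<- Wy0] := supp_dcond Wx; exact: H'.
Qed.

End Joint.

(** * The simulating resolution *)

Section Play.
Context {R : realType} {Act : Type} {Omega T P Q : choiceType}.
Variables (TT : plts R T (Act + Omega)) (PP : plts R P Act).
Variables (QQ : plts R Q Omega) (f0 : Q -> T * P).
Hypothesis test : test_conditions TT.
Hypothesis det : deterministic QQ.
Hypothesis Qtrans : forall r a E, trans QQ r a E -> trans (par TT PP) (f0 r) a (dpush f0 E).
Hypothesis Qenables : forall r a, enables (par TT PP) (f0 r) a -> enables QQ r a.

Local Notation X := (sdT R P).
Local Notation moves := (P * option (sdT R P))%type.

(* A phase is the execution, against an idle test, of a weak derivation of the
   simulating process: [Settle] answers the internal moves of the simulated
   process up to the next move of the test, [Prepare] leads to the point where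
   that move is made, and [Recover] follows a synchronisation; [Recover None] is
   the derivation at the start. [Run i t k q] is the state [q] after [k] steps of
   phase [i] against [t], before it is drawn whether to stop there ([Done]) or
   which transition to take ([Go]). *)
Inductive phase := Settle of Q & X | Prepare of Q & X | Recover of option (Q * X).

Inductive position :=
| Run of phase & T & nat & P
| Go of phase & T & nat & P & X
| Done of phase & T & P
| Ready of Q & X & P
| Sync of Q & X & P & X
| Free of T * P.

Definition pos : choiceType := {classic position}.

Definition fpos (x : pos) : T * P :=
  match x with
  | Run _ t _ q | Go _ t _ q _ | Done _ t q => (t, q)
  | Ready r _ q | Sync r _ q _ => ((f0 r).1, q)
  | Free c => c
  end.

(** The silent order is [Recover], [Settle], [Prepare], [Ready], [Sync]. Phases lie two apart
    because [Run] ranks one above the [Done] of its phase. *)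
Definition phase_rank (i : phase) : nat :=
  match i with Settle _ _ => 4 | Prepare _ _ => 2 | Recover _ => 6 end.

Definition rank (x : pos) : nat :=
  match x with
  | Run i _ _ _ => (phase_rank i).+1
  | Done i _ _ => phase_rank i
  | Ready _ _ _ => 1
  | _ => 0
  end.

Variables (plN : phase -> nat -> subdist R moves) (plJ : phase -> subdist R pos).
Variables (plW : Q -> X -> subdist R (P * X)%type) (plT : Q -> X -> subdist R T).

Definition test_move (r : Q) : bool := `[< exists2 E, tau_next QQ r = Some E &
  exists2 Th, trans TT (f0 r).1 None Th & dpush f0 E = dprod Th (dpoint (f0 r).2) >].

Definition run_next i t k q (m : moves) : pos :=
  if m.2 is Some E then Go i t k q E else Done i t q.

(** Draws are conditioned on the current state, so that averaging over that state restores the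
    intended joint law. [Free] is left to the fallback scheduler. *)
Definition raw (x : pos) : subdist R pos :=
  match x with
  | Run i t k q => dpush (run_next i t k q) (dcond (plN i k) fst q)
  | Go i t k q E => dpush (fun q' => Run i t k.+1 q' : pos) (sdv E)
  | Done i t q => dcond (plJ i) fpos (t, q)
  | Ready r F q =>
      if tau_next QQ r is Some E then
        if test_move r then
          dpush (fun r' => Run (Settle r' F) (f0 r').1 0 q : pos) E
        else dpush (fun m => Sync r F q m.2 : pos) (dcond (plW r F) fst q)
      else dzero pos
  | Sync r F q E =>
      dpush (fun y => Run (Recover (Some (r, F))) y.1 0 y.2 : pos) (dprod (plT r F) (sdv E))
  | Free _ => dzero pos
  end.

Local Notation vn := (vnext (par TT PP) fpos Free raw rank).
Local Notation vs := (vsucc (pos := pos) (par TT PP) fpos).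
Local Notation sG := (succeeds QQ).
Local Notation kG := (tau_next QQ).

Lemma vn_persistent : persistent vs vn.
Proof. by apply: vnext_persistent => // c w E c'; exact: par_stable. Qed.

Lemma vsE x w : vs x w = tsucc TT (fpos x).1 w.
Proof. exact: par_succeeds. Qed.

Lemma silent_vn x : full (raw x) ->
  (forall y, raw x y != 0 -> fpos y = fpos x /\ (rank y < rank x)%N) ->
  vn x = Some (raw x).
Proof.
move=> fx Hx; rewrite /vnext; case E : (observable _ _ _ x) => //=.
by rewrite /silent E /= asboolT.
Qed.

Lemma observable_vn x : trans (par TT PP) (fpos x) None (dpush fpos (raw x)) ->
  vn x = Some (raw x).
Proof. by move=> tx; rewrite /vnext /observable asboolT. Qed.

Lemma vn_run i t k q : dpush fst (plN i k) q != 0 -> vn (Run i t k q) = Some (raw (Run i t k q)).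
Proof.
move=> Nq; apply: silent_vn; first by rewrite full_push; exact: dcond_full.
by move=> y /supp_push[[s [E|]] _ <-] /=.
Qed.

Lemma vn_go i t k q E : trans PP q None (sdv E) ->
  vn (Go i t k q E) = Some (raw (Go i t k q E)).
Proof.
move=> qE; apply: observable_vn.
rewrite (_ : dpush _ _ = dprod (dpoint t) (sdv E)); first exact: par_proc.
by apply: sd_eqEx => f f_ge0; rewrite !Ex_push Ex_prod Ex_point.
Qed.

Lemma vn_done i t q : dpush fpos (plJ i) (t, q) != 0 ->
  (forall x, plJ i x != 0 -> (rank x < phase_rank i)%N) ->
  vn (Done i t q) = Some (raw (Done i t q)).
Proof.
move=> Jq rJ; apply: silent_vn; first exact: dcond_full.
by move=> y /supp_dcond[-> /rJ].
Qed.

(** The play is never compared with the resolution at a single [q], only on average over [q], where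
    conditioning disappears. *)
Lemma avg_run i t k g : Ex (dpush fst (plN i k)) (fun q => Ex (raw (Run i t k q)) g) =
  Ex (plN i k) (fun m => g (run_next i t k m.1 m)).
Proof.
rewrite -[RHS](Ex_dcond _ fst); apply: eq_Ex => q _; rewrite /raw Ex_push.
by apply: eq_Ex => m /supp_dcond[<- _].
Qed.

Lemma avg_next i t k g g' : (forall x, 0 <= g x)%E -> (forall x, 0 <= g' x)%E ->
  (forall s E, plN i k (s, Some E) != 0 -> trans PP s None E) ->
  dpush fst (plN i k.+1) = dmix (plN i k) target ->
  (forall q E, trans PP q None (sdv E) ->
     g (Go i t k q E) = Ex (raw (Go i t k q E)) g') ->
  (Ex (plN i k) (fun m => g (run_next i t k m.1 m)) =
   Ex (plN i k) (fun m => if m.2 is None then g (Done i t m.1) else 0) +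
   Ex (dpush fst (plN i k.+1)) (fun q => g' (Run i t k.+1 q)))%E.
Proof.
move=> g0 g0' NT NS gE; rewrite NS Ex_mix -Ex_add//; last by move=> [s [E|]] /=.
apply: eq_Ex => -[s [E|]] Nm; rewrite /run_next /target /=; last first.
  by rewrite Ex_zero adde0.
by rewrite add0e gE ?Ex_push//; exact: NT Nm.
Qed.

Definition phase_spec i (th : subdist R T) (E E' : subdist R P) : Prop :=
  [/\ derivation PP (plN i) E E', full E', dpush fpos (plJ i) = dprod th E' &
      forall x, plJ i x != 0 -> (rank x < phase_rank i)%N].

Lemma avg_done i th E E' g : phase_spec i th E E' ->
  Ex th (fun t => Ex E' (fun q => Ex (raw (Done i t q)) g)) = Ex (plJ i) g.
Proof. by move=> [_ _ JE _]; rewrite -(Ex_dcond _ fpos) JE Ex_prod. Qed.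

Lemma phase_vn_done i th E E' t q : phase_spec i th E E' -> th t != 0 -> E' q != 0 ->
  vn (Done i t q) = Some (raw (Done i t q)).
Proof.
by move=> [_ _ JE rJ] tht Eq; apply: vn_done => //; rewrite JE; apply/supp_prod.
Qed.

Lemma vn_act_test r F q : test_move r -> vn (Ready r F q) = Some (raw (Ready r F q)).
Proof.
move=> tr; apply: observable_vn; rewrite /raw tr.
move/asboolP: tr => [E -> [Th tTh fE]].
rewrite (_ : dpush _ _ = dprod Th (dpoint q)); first exact: par_test.
apply: sd_eqEx => f f_ge0; rewrite !Ex_push.
transitivity (Ex (dpush f0 E) (fun y => f (y.1, q))); first by rewrite Ex_push.
by rewrite fE !Ex_prod; apply: eq_Ex => t _; rewrite !Ex_point.
Qed.

Lemma vn_act_sync r F q E : tau_next QQ r = Some E -> ~~ test_move r ->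
  dpush fst (plW r F) q != 0 -> vn (Ready r F q) = Some (raw (Ready r F q)).
Proof.
move=> rE /negbTE tr Wq; apply: silent_vn; rewrite /raw rE tr.
  by rewrite full_push; exact: dcond_full.
by move=> y /supp_push[m _ <-].
Qed.

Lemma vn_sync r F q E a : trans TT (f0 r).1 (Some (inl a)) (plT r F) ->
  trans PP q (Some a) (sdv E) -> vn (Sync r F q E) = Some (raw (Sync r F q E)).
Proof.
move=> tT qE; apply: observable_vn.
rewrite (_ : dpush _ _ = dprod (plT r F) (sdv E)); first exact: par_sync tT qE.
apply: sd_eqEx => f f_ge0; rewrite !Ex_push !Ex_prod.
by apply: eq_Ex => t _; apply: eq_Ex.
Qed.

Lemma vn_act_dead r F q : tau_next QQ r = None ->
  ~ enables (par TT PP) ((f0 r).1, q) None -> vn (Ready r F q) = None.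
Proof.
move=> rN dead; rewrite /vnext /observable asboolF; last first.
  by move=> tx; apply: dead; eexists; exact: tx.
rewrite /silent asboolF; last first.
  by rewrite /raw rN => -[/fullE]; rewrite Ex_zero => /esym/eqP; rewrite onee_eq0.
rewrite andbF /fallback; case E : (tau_next _ _) => [mu|//].
by exfalso; apply: dead; exists mu; exact: tau_next_trans E.
Qed.

Variable D0 : subdist R P.
Local Notation sim := (simulated PP D0).
Local Notation proc_move := (process_move PP QQ f0).

Definition to_prepare (x : (Q * X) * P) : pos := Run (Prepare x.1.1 x.1.2) (f0 x.1.1).1 0 x.2.
Definition to_settle (x : (Q * X) * P) : pos := Run (Settle x.1.1 x.1.2) (f0 x.1.1).1 0 x.2.

Definition settle_spec r (F : X) : Prop := exists B G E W,
  [/\ phase_spec (Settle r F) (dpoint (f0 r).1) F E,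
      plJ (Settle r F) = dpush to_prepare (joint f0 B W),
      dpush f0 B = dprod (dpoint (f0 r).1) G,
      coupling sim G E W &
      [/\ forall r', B r' != 0 -> ~~ proc_move r',
          forall w, (Ex B (lval sG kG ^~ w) <= lval sG kG r w)%E &
          forall n w, ~~ sG r w -> (itv sG kG n r w <= Ex B (itv sG kG n ^~ w))%E] ].

(** The same condition describes the start of the play, with index [Recover None]. *)
Definition recover_spec i (th : subdist R T) (B : subdist R Q) (E : subdist R P) : Prop :=
  exists G E' W, [/\ phase_spec i th E E', plJ i = dpush to_settle (joint f0 B W),
    dpush f0 B = dprod th G & coupling sim G E' W].

Definition prepare_spec r (F : X) : Prop := exists S : subdist R P,
  [/\ phase_spec (Prepare r F) (dpoint (f0 r).1) F S,
      plJ (Prepare r F) = dpush (fun q => Ready r F q : pos) S &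
      if tau_next QQ r is Some B then
        if test_move r then S = sdv F else
        exists a E, [/\ trans TT (f0 r).1 (Some (inl a)) (plT r F),
          coupling (fun s E' => trans PP s (Some a) E') S E (plW r F) &
          recover_spec (Recover (Some (r, F))) (plT r F) B E]
      else forall q, S q != 0 -> ~ enables (par TT PP) ((f0 r).1, q) None].

Hypothesis settle : forall r (F : X), sim (f0 r).2 F -> settle_spec r F.
Hypothesis prepare : forall r (F : X), sim (f0 r).2 F -> ~~ proc_move r -> prepare_spec r F.

(** * Value bounds for one success action *)

Section FixedOutcome.
Variable w : Omega.
Definition pval (x : pos) : \bar R := lval vs vn x w.
Definition pitv m (x : pos) : \bar R := itv vs vn m x w.
Definition rval (r : Q) : \bar R := lval sG kG r w.
Definition ritv m (r : Q) : \bar R := itv sG kG m r w.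
Local Notation V := pval.
Local Notation I := pitv.
Local Notation VG := rval.
Local Notation IG := ritv.

Lemma pval_ge0 x : (0 <= V x)%E. Proof. exact: lval_ge0. Qed.
Lemma pitv_ge0 m x : (0 <= I m x)%E. Proof. exact: itv_ge0. Qed.
Lemma rval_ge0 r : (0 <= VG r)%E. Proof. exact: lval_ge0. Qed.
Lemma ritv_ge0 m r : (0 <= IG m r)%E. Proof. exact: itv_ge0. Qed.
Hint Resolve pval_ge0 pitv_ge0 rval_ge0 ritv_ge0 : core.

Lemma V_step x : vn x = Some (raw x) -> V x = Ex (raw x) V.
Proof. exact: (lval_step vn_persistent). Qed.

Lemma I_step m x : vn x = Some (raw x) -> I m.+1 x = Ex (raw x) (I m).
Proof. exact: (itv_step vn_persistent). Qed.

Lemma I_le m x : vn x = Some (raw x) -> (I m x <= Ex (raw x) (I m))%E.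
Proof. by move=> xE; rewrite -I_step//; exact: itv_mono. Qed.

Lemma V_tsucc x : tsucc TT (fpos x).1 w -> V x = 1%E.
Proof. by rewrite -vsE => sx; rewrite /pval lval_succ. Qed.

Lemma I_tsucc m x : tsucc TT (fpos x).1 w -> I m x = 1%E.
Proof. by rewrite -vsE => sx; rewrite /pitv itv_succ. Qed.

Lemma run_lower i t E E' : derivation PP (plN i) E E' ->
  (Ex E' (fun q => V (Done i t q)) <= Ex E (fun q => V (Run i t 0 q)))%E.
Proof.
move=> [NI NS NT NF]; rewrite NF//.
rewrite -NI; apply: (telescope_ge
  (a := fun k => Ex (dpush fst (plN i k)) (fun q => V (Run i t k q)))) => k; rewrite ?Ex_ge0//.
apply: (@le_trans _ _ (Ex (plN i k) (fun m => V (run_next i t k m.1 m)))).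
  rewrite (avg_next (g := V) (g' := V))//; first exact: NT.
  by move=> q F qF; apply: V_step; exact: vn_go.
rewrite -avg_run; apply: le_Ex => [q|q Nq]; first exact: Ex_ge0.
by rewrite [leRHS]V_step// vn_run.
Qed.

(** Under a successful test the right side is one because [E'] is full; otherwise the iterates
    telescope along the derivation. *)
Lemma run_upper i t E E' m : derivation PP (plN i) E E' -> full E' ->
  (Ex E (fun q => I m (Run i t 0 q)) <= Ex E' (fun q => I m (Done i t q)))%E.
Proof.
move=> [NI NS NT NF] fE'; have [st|st] := boolP (tsucc TT t w).
  rewrite [leRHS](eq_Ex (g := fun=> 1%E)); last by move=> q _; exact: I_tsucc.
  by rewrite (Ex_cst fE')//; apply: Ex_le => // q _; exact: itv_le1.
rewrite NF//.
rewrite -NI; apply: (telescope_le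
  (a := fun m k => Ex (dpush fst (plN i k)) (fun q => I m (Run i t k q)))
  (b := fun m k => Ex (plN i k) (fun x => if x.2 is None then I m (Done i t x.1) else 0%E))).
- by move=> k; exact: Ex_ge0.
- by move=> k; apply: Ex_eq0 => q _; rewrite /pitv /= vsE (negbTE st).
- move=> m' k; rewrite (eq_Ex (g := fun q => Ex (raw (Run i t k q)) (I m'))); last first.
    by move=> q Nq; rewrite I_step// vn_run.
  rewrite avg_run.
  (* The silent draw costs one iterate. By monotonicity it is given back at [Go], whose visible move
     then spends it. *)
  apply: (@le_trans _ _ (Ex (plN i k) (fun x => if x.2 is Some F then
      I m'.+1 (Go i t k x.1 F) else I m' (Done i t x.1)))).
    apply: le_Ex => // x _.
    by rewrite /run_next; case: x.2 => [F|//]; exact: itv_mono.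
  rewrite NS Ex_mix -Ex_add//; last by move=> [s [F|]] /=.
  apply: le_Ex => [[s [F|]]|[s [F|]] Nm] //=; rewrite /target /=.
    by rewrite add0e I_step ?Ex_push//; apply: vn_go; exact: NT Nm.
  by rewrite Ex_zero adde0.
- move=> j k jm; apply: le_Ex => -[s [F|]] //=.
  move=> _; rewrite -(subnK jm); elim: (m - _)%N => [|d IHd].
    exact: itv_mono.
  exact: le_trans IHd (itv_mono _ _ _ _ _).
Qed.

Lemma phase_lower i th E E' : phase_spec i th E E' ->
  (Ex (plJ i) V <= Ex th (fun t => Ex E (fun q => V (Run i t 0 q))))%E.
Proof.
move=> H; have [HN _ _ _] := H; rewrite -(avg_done V H); apply: le_Ex => // t tht.
apply: le_trans (run_lower t HN); apply: le_Ex => // q Eq.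
by rewrite [leRHS]V_step//; exact: phase_vn_done H tht Eq.
Qed.

Lemma phase_upper m i th E E' : phase_spec i th E E' ->
  (Ex th (fun t => Ex E (fun q => I m (Run i t 0 q))) <= Ex (plJ i) (I m))%E.
Proof.
move=> H; have [HN fE' _ _] := H; rewrite -(avg_done (I m) H); apply: le_Ex => // t tht.
apply: le_trans (run_upper t m HN fE') _; apply: le_Ex => // q Eq.
by apply: I_le; exact: phase_vn_done H tht Eq.
Qed.

Lemma VG_tsucc r : tsucc TT (f0 r).1 w -> VG r = 1%E.
Proof. by rewrite -(succ_res Qtrans Qenables) => sr; rewrite /rval lval_succ. Qed.

Lemma VG_step r B : kG r = Some B -> VG r = Ex B VG.
Proof. exact: (lval_step (res_persistent test Qtrans Qenables)). Qed.

Lemma IG_step n r B : kG r = Some B -> IG n.+1 r = Ex B (IG n).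
Proof. exact: (itv_step (res_persistent test Qtrans Qenables)). Qed.

Lemma VG_ge_I0 r x : (fpos x).1 = (f0 r).1 -> (I 0 x <= VG r)%E.
Proof.
move=> xr; have [st|st] := boolP (tsucc TT (f0 r).1 w).
  by rewrite VG_tsucc//; exact: itv_le1.
by rewrite /pitv /= vsE xr (negbTE st).
Qed.

Lemma test_move_supp r B r' : kG r = Some B -> test_move r -> B r' != 0 ->
  (f0 r').2 = (f0 r).2.
Proof.
move=> rB /asboolP[B' + [Th _ fB]] Br'; rewrite rB => -[BB']; subst B'.
have : dpush f0 B (f0 r') != 0 by apply/supp_push; exists r'.
by rewrite fB => /supp_prod[_ /supp_point].
Qed.

(** [upper] bounds iterates of the play by the value of the resolution, and [lower] does the
    converse. Both compare at the start of settling, the recurring point of the play. *)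
Definition upper m := forall r (F : X), sim (f0 r).2 F ->
  (Ex (sdv F) (fun q => I m (Run (Settle r F) (f0 r).1 0 q)) <= VG r)%E.

Definition lower n := forall r (F : X), sim (f0 r).2 F ->
  (IG n r <= Ex (sdv F) (fun q => V (Run (Settle r F) (f0 r).1 0 q)))%E.

Lemma recover_upper m i th B E : upper m -> recover_spec i th B E ->
  (Ex th (fun t => Ex E (fun q => I m (Run i t 0 q))) <= Ex B VG)%E.
Proof.
move=> IH [G [E' [W [H HJ fB HW]]]]; apply: (le_trans (phase_upper m H)).
by rewrite HJ Ex_push; apply: (joint_le HW) => // r F Br rF; exact: IH.
Qed.

Lemma recover_lower n i th B E : lower n -> recover_spec i th B E ->
  (Ex B (IG n) <= Ex th (fun t => Ex E (fun q => V (Run i t 0 q))))%E.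
Proof.
move=> IH [G [E' [W [H HJ fB HW]]]]; apply: le_trans (phase_lower H).
by rewrite HJ Ex_push; apply: (joint_ge HW fB) => // r F Br rF; exact: IH.
Qed.

Lemma act_sync_average r (F : X) S E a B g :
  coupling (fun s E' => trans PP s (Some a) E') S E (plW r F) ->
  kG r = Some B -> ~~ test_move r ->
  Ex S (fun q => Ex (raw (Ready r F q)) g) = Ex (plW r F) (fun x => g (Sync r F x.1 x.2)).
Proof.
move=> [_ <- _] rB /negbTE tr; rewrite -[RHS](Ex_dcond _ fst); apply: eq_Ex => q _.
by rewrite /raw rB tr Ex_push; apply: eq_Ex => x /supp_dcond[<- _].
Qed.

Lemma sync_average r (F : X) S E a g :
  coupling (fun s E' => trans PP s (Some a) E') S E (plW r F) ->
  Ex (plW r F) (fun x => Ex (raw (Sync r F x.1 x.2)) g) =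
  Ex (plT r F) (fun t => Ex E (fun q => g (Run (Recover (Some (r, F))) t 0 q))).
Proof.
move=> [_ _ <-]; transitivity (Ex (plW r F) (fun x => Ex (plT r F) (fun t =>
    Ex (sdv x.2) (fun q => g (Run (Recover (Some (r, F))) t 0 q))))).
  by apply: eq_Ex => x _; rewrite /raw Ex_push Ex_prod.
by rewrite Ex_exchange; apply: eq_Ex => t _; rewrite Ex_mix.
Qed.

(** Before the next settling, a visible move spends an iterate: the test move at [Ready] or the
    synchronisation at [Sync]. In a deadlock only success counts. *)
Lemma prepare_upper m r (F : X) : (forall m', (m' < m)%N -> upper m') ->
  sim (f0 r).2 F -> ~~ proc_move r ->
  (Ex (sdv F) (fun q => I m (Run (Prepare r F) (f0 r).1 0 q)) <= VG r)%E.
Proof.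
move=> IH rF npr; have [S [H HJ Hr]] := prepare rF npr.
apply: (@le_trans _ _ (Ex S (fun q => I m (Ready r F q)))).
  have := phase_upper m H; rewrite Ex_point; last exact: Ex_ge0.
  by rewrite HJ Ex_push.
have base : (Ex S (fun q => I 0 (Ready r F q)) <= VG r)%E.
  by apply: Ex_le => // q _; exact: VG_ge_I0.
case: m IH => [//|m] IH; case rB : (tau_next QQ r) Hr => [B|]; last first.
  move=> dead; apply: le_trans base; apply: le_Ex => // q Sq.
  by rewrite /pitv /= (vn_act_dead F rB (dead q Sq)).
case: ifP => [tr SF|/negbT tr [a [E [tT HW HR]]]].
  rewrite SF (VG_step rB).
  apply: (@le_trans _ _ (Ex (sdv F) (fun q => Ex (raw (Ready r F q)) (I m)))).
    by apply: le_Ex => // q _; rewrite I_step//; exact: vn_act_test.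
  rewrite (eq_Ex (g := fun q => Ex B (fun r' => I m (Run (Settle r' F) (f0 r').1 0 q)))); last first.
    by move=> q _; rewrite /raw rB tr Ex_push.
  rewrite Ex_exchange; apply: le_Ex => // r' Br'.
  by apply: (IH m) => //; rewrite (test_move_supp rB tr Br').
rewrite (VG_step rB); apply: le_trans (recover_upper (IH m (ltnSn m)) HR).
rewrite -(sync_average _ HW).
apply: (@le_trans _ _ (Ex (plW r F) (fun x => I m.+1 (Sync r F x.1 x.2)))).
  rewrite -(act_sync_average _ HW rB tr); apply: le_Ex => // q Sq.
  by apply: I_le; apply: (vn_act_sync rB tr); have [_ -> _] := HW.
apply: le_Ex => // x Wx; have [H1 _ _] := HW.
by rewrite I_step//; exact: vn_sync tT (H1 x Wx).
Qed.

(** Settling itself need not lower the iterate, but the move prepared after it does; hence strong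
    induction on [m]. *)
Lemma upper_all m : upper m.
Proof.
have [n mn] : exists n, (m < n)%N by exists m.+1.
elim: n m mn => [//|n IH] m mn r F rF.
have [B [G [E [W [H HJ fB HW [Bnp Bval _]]]]]] := settle rF.
have := phase_upper m H; rewrite Ex_point; last exact: Ex_ge0.
move=> /le_trans; apply; apply: le_trans (Bval w).
rewrite HJ Ex_push; apply: (joint_le HW) => // r' F' Br' rF'.
apply: prepare_upper => //; last exact: Bnp.
by move=> m' m'm; apply: IH; exact: leq_trans m'm _.
Qed.

Lemma V1_lower n r E (g : P -> pos) : full E -> (forall q, (fpos (g q)).1 = (f0 r).1) ->
  tsucc TT (f0 r).1 w -> (IG n r <= Ex E (fun q => V (g q)))%E.
Proof.
move=> fE gr st; rewrite (eq_Ex (g := fun=> 1%E)); last first.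
  by move=> q _; apply: V_tsucc; rewrite gr.
by rewrite Ex_cst//; exact: itv_le1.
Qed.

Lemma prepare_lower n r (F : X) : (forall m', (m' < n)%N -> lower m') ->
  sim (f0 r).2 F -> ~~ proc_move r ->
  (IG n r <= Ex (sdv F) (fun q => V (Run (Prepare r F) (f0 r).1 0 q)))%E.
Proof.
move=> IH rF npr; have [st|st] := boolP (tsucc TT (f0 r).1 w).
  by apply: V1_lower => //; have [_ []] := rF.
have nsr : sG r w = false by rewrite (succ_res Qtrans Qenables) (negbTE st).
have [S [H HJ Hr]] := prepare rF npr.
apply: (@le_trans _ _ (Ex S (fun q => V (Ready r F q)))); last first.
  have := phase_lower H; rewrite Ex_point; last exact: Ex_ge0.
  by rewrite HJ Ex_push.
case: n IH => [|n] IH; first by rewrite /ritv /= nsr.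
case rB : (tau_next QQ r) Hr => [B|]; last by rewrite /ritv /= nsr rB.
rewrite (IG_step n rB).
case: ifP => [tr ->|/negbT tr [a [E [tT HW HR]]]].
  rewrite (eq_Ex (g := fun q => Ex B (fun r' => V (Run (Settle r' F) (f0 r').1 0 q)))
    (f := fun q => V (Ready r F q))); last first.
    by move=> q _; rewrite V_step ?vn_act_test// /raw rB tr Ex_push.
  rewrite Ex_exchange; apply: le_Ex => // r' Br'.
  by apply: (IH n) => //; rewrite (test_move_supp rB tr Br').
apply: (le_trans (recover_lower (IH n (ltnSn n)) HR)).
rewrite -(sync_average _ HW).
rewrite (eq_Ex (g := fun q => Ex (raw (Ready r F q)) V) (f := fun q => V (Ready r F q))); last first.
  by move=> q Sq; apply: V_step; apply: (vn_act_sync rB tr); have [_ -> _] := HW.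
rewrite (act_sync_average _ HW rB tr); apply: le_Ex => // x Wx; have [H1 _ _] := HW.
by rewrite [leRHS]V_step//; exact: vn_sync tT (H1 x Wx).
Qed.

Lemma lower_all n : lower n.
Proof.
have [k nk] : exists k, (n < k)%N by exists n.+1.
elim: k n nk => [//|k IH] n nk r F rF.
have [st|st] := boolP (tsucc TT (f0 r).1 w).
  by apply: V1_lower => //; have [_ []] := rF.
have [B [G [E [W [H HJ fB HW [Bnp _ Bitv]]]]]] := settle rF.
apply: (@le_trans _ _ (Ex B (IG n))).
  by apply: Bitv; rewrite (succ_res Qtrans Qenables).
have := phase_lower H; rewrite Ex_point; last exact: Ex_ge0.
apply: le_trans; rewrite HJ Ex_push; apply: (joint_ge HW fB) => // r' F' Br' rF'.
apply: prepare_lower => //; last exact: Bnp.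
by move=> m' m'n; apply: IH; exact: leq_trans m'n _.
Qed.

(** Each side is a supremum of iterates, every one of which is bounded by the other side. *)
Lemma recover_value i th B E : recover_spec i th B E ->
  Ex th (fun t => Ex E (fun q => V (Run i t 0 q))) = Ex B VG.
Proof.
move=> HR; apply/eqP; rewrite eq_le; apply/andP; split; last first.
  rewrite /rval Ex_val; apply: ge_ereal_sup => _ [n _ <-].
  exact: (recover_lower (lower_all n) HR).
rewrite -(Ex_prod th E (fun y => V (Run i y.1 0 y.2))).
rewrite -(Ex_push (fun y => Run i y.1 0 y.2 : pos)) /pval Ex_val.
apply: ge_ereal_sup => _ [m _ <-]; rewrite Ex_push Ex_prod.
exact: (recover_upper (upper_all m) HR).
Qed.

End FixedOutcome.

Lemma recover_outcome i (th : subdist R T) B (E : subdist R P) (o : Omega -> R) :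
  recover_spec i th B E -> (forall w, (o w)%:E = Ex B (lval sG kG ^~ w)) ->
  outcomes (par TT PP) (dprod th E) o.
Proof.
move=> HR Ho.
have -> : dprod th E = dpush fpos (dpush (fun y => Run i y.1 0 y.2 : pos) (dprod th E)).
  apply: sd_eqEx => f f_ge0; rewrite !Ex_push !Ex_prod.
  by apply: eq_Ex => t _; apply: eq_Ex.
have stable c w E' c' : enables (par TT PP) c (Some w) -> trans (par TT PP) c None E' ->
    E' c' != 0 -> enables (par TT PP) c' (Some w) by exact: par_stable.
apply: (@elimination R _ _ pos (par TT PP) fpos Free raw rank _ stable) => // w.
rewrite Ho -[LHS](recover_value w HR) Ex_push Ex_prod.
by apply: eq_Ex => t _; apply: eq_Ex.
Qed.

End Play.

(** * Choosing the answers and assembling the play *)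

Section Strategy.
Context {R : realType} {Act : Type} {Omega T P Q : choiceType}.
Variables (TT : plts R T (Act + Omega)) (PP : plts R P Act).
Variables (QQ : plts R Q Omega) (f0 : Q -> T * P).
Hypothesis test : test_conditions TT.
Hypothesis det : deterministic QQ.
Hypothesis Qtrans : forall r a E, trans QQ r a E -> trans (par TT PP) (f0 r) a (dpush f0 E).
Hypothesis Qenables : forall r a, enables (par TT PP) (f0 r) a -> enables QQ r a.
Variable D0 : subdist R P.
Hypotheses (finD : finitary PP D0) (convD : convergent PP D0).

Local Notation X := (sdT R P).
Local Notation moves := (P * option (sdT R P))%type.
Local Notation sim := (simulated PP D0).
Local Notation sG := (succeeds QQ).
Local Notation kG := (tau_next QQ).

(** A flat record of data, so that one use of choice selects the answers for all pairs of a state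
    and a simulating distribution; where a clause does not apply its fields are arbitrary. *)
Record strategy := Strategy {
  settleN : nat -> subdist R moves ;
  settleB : subdist R Q ;
  settleW : subdist R (P * X)%type ;
  prepareN : nat -> subdist R moves ;
  prepareE : subdist R P ;
  syncT : subdist R T ;
  syncW : subdist R (P * X)%type ;
  recoverN : nat -> subdist R moves ;
  recoverW : subdist R (P * X)%type }.

Definition settle_ok r (F : X) st : Prop := exists G E,
  [/\ derivation PP (settleN st) F E, reachable_full PP D0 E,
      dpush f0 (settleB st) = dprod (dpoint (f0 r).1) G,
      coupling sim G E (settleW st) &
      [/\ forall r', settleB st r' != 0 -> ~~ process_move PP QQ f0 r',
          forall w, (Ex (settleB st) (lval sG kG ^~ w) <= lval sG kG r w)%E &
          forall n w, ~~ sG r w ->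
            (itv sG kG n r w <= Ex (settleB st) (itv sG kG n ^~ w))%E] ].

Definition prepare_ok r (F : X) st : Prop :=
  [/\ derivation PP (prepareN st) F (prepareE st), reachable_full PP D0 (prepareE st) &
      if kG r is Some B then
        if test_move TT QQ f0 r then prepareE st = sdv F else
        exists a E G E', [/\ trans TT (f0 r).1 (Some (inl a)) (syncT st),
          coupling (fun s E' => trans PP s (Some a) E') (prepareE st) E (syncW st),
          derivation PP (recoverN st) E E', reachable_full PP D0 E' &
          dpush f0 B = dprod (syncT st) G /\ coupling sim G E' (recoverW st)]
      else forall q, prepareE st q != 0 -> ~ enables (par TT PP) ((f0 r).1, q) None].

(** The fields of the other clause stay universally quantified, so that independently found halves
    fit into one record. *)
Lemma settle_ex r (F : X) : sim (f0 r).2 F -> exists N B W, forall N' E' t W' N'' W'',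
  settle_ok r F (Strategy N B W N' E' t W' N'' W'').
Proof.
move=> rF; have [B [pB B1 B2 B3]] := process_run test Qtrans Qenables r.
have [N [E [W [HN iE HW]]]] := match_tau finD convD rF pB.
exists N, B, W => *; exists (dpush (snd \o f0) B), E; split => //=.
  apply: sd_eqEx => f f_ge0; rewrite Ex_push Ex_prod Ex_point; last exact: Ex_ge0.
  by rewrite Ex_push; apply: eq_Ex => r' /B1[_ <-] /=; case: (f0 r').
by split => // r' /B1[].
Qed.

Lemma prepare_ex r (F : X) : sim (f0 r).2 F -> ~~ process_move PP QQ f0 r ->
  exists N' E' t W' N'' W'', forall N B W,
  prepare_ok r F (Strategy N B W N' E' t W' N'' W'').
Proof.
move=> rF npr; have [_ iF] := rF.
have [N0 HN0] := idle_derivation PP (sdv F).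
rewrite /prepare_ok /=; case rB : (kG r) => [B|]; last first.
  (* [A] collects the actions offered by the test. As [r] has no internal move, the process refuses
     all of them, and so does the answer. *)
  pose A := [set b | enables TT (f0 r).1 (Some (inl b))].
  have dead : ~ enables (par TT PP) (f0 r) None.
    by move=> /Qenables[B tB]; rewrite (tau_next_det det tB) in rB.
  have [|N [E [HN iE EA]]] := match_refuse finD convD (A := A) rF.
    split; first by move=> [D' pD]; apply: dead; rewrite [f0 r]surjective_pairing;
      eexists; exact: par_proc pD.
    move=> b [Th tTh] [D' pD]; apply: dead; rewrite [f0 r]surjective_pairing.
    by eexists; exact: par_sync tTh pD.
  exists N, E, (dzero T), (dzero _), N0, (dzero _) => *; split => //.
  move=> q Eq [D' /par_transP[[Th tTh _]|[E' qE _]|[a [Th [E' [tTh qE _]]]]]].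
  - apply: dead; rewrite [f0 r]surjective_pairing.
    by eexists; exact: par_test tTh.
  - by have [H _] := EA q Eq; apply: H; exists E'.
  - have [_ /(_ a)] := EA q Eq; apply; first by exists Th.
    by exists E'.
have [tr|tr] := boolP (test_move TT QQ f0 r).
  by exists N0, F, (dzero T), (dzero _), N0, (dzero _).
have := Qtrans (tau_next_trans rB).
case/par_transP => [[Th tTh fB]|[D' pD fB]|[a [Th [G [tTh pG fB]]]]].
- by case/negP: tr; apply/asboolP; exists B => //; exists Th.
- by case/negP: npr; apply/asboolP; exists B => //; exists D'.
have [N [E1 [Wa [E2 [N' [E3 [W [HN i1 HWa HN' [i3 HW]]]]]]]]] := match_act finD convD rF pG.
by exists N, E1, Th, Wa, N', W => *; split => //; exists a, E2, G, E3.
Qed.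

Lemma strategy_ex : exists st : Q -> X -> strategy, forall r F, sim (f0 r).2 F ->
  settle_ok r F (st r F) /\ (~~ process_move PP QQ f0 r -> prepare_ok r F (st r F)).
Proof.
have /choice[st Hst] : forall x : Q * X, exists st, sim (f0 x.1).2 x.2 ->
    settle_ok x.1 x.2 st /\ (~~ process_move PP QQ f0 x.1 -> prepare_ok x.1 x.2 st).
  move=> [r F] /=; have z : strategy by split => *; exact: dzero.
  have [rF|] := pselect (sim (f0 r).2 F); last by exists z.
  have [N [B [W H1]]] := settle_ex rF.
  have [npr|pr] := boolP (~~ process_move PP QQ f0 r).
    have [N' [E' [t [W' [N'' [W'' H2]]]]]] := prepare_ex rF npr.
    by exists (Strategy N B W N' E' t W' N'' W'').
  by exists (Strategy N B W (prepareN z) (prepareE z) (syncT z) (syncW z) (recoverN z) (recoverW z)).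
by exists (fun r F => st (r, F)) => r F; exact: Hst (r, F).
Qed.

Lemma simulation_outcome (Lam : subdist R Q) (th : subdist R T) (G E E' : subdist R P) N0 W0 o :
  dpush f0 Lam = dprod th G -> derivation PP N0 E E' -> full E' -> coupling sim G E' W0 ->
  (forall w, (o w)%:E = Ex Lam (lval sG kG ^~ w)) -> outcomes (par TT PP) (dprod th E) o.
Proof.
move=> fLam HN0 fE' HW0 Ho; have [st Hst] := strategy_ex.
(* Every phase takes its data from the strategy except [Recover None], which starts the play from
   the given derivation, [Lam] and [W0]. *)
pose plN (i : phase) := match i with
  | Settle r F => settleN (st r F)
  | Prepare r F => prepareN (st r F)
  | Recover (Some x) => recoverN (st x.1 x.2)
  | Recover None => N0 end.
pose plJ (i : phase) : subdist R (@pos R T P Q) := match i with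
  | Settle r F => dpush (@to_prepare _ _ _ _ f0) (joint f0 (settleB (st r F)) (settleW (st r F)))
  | Prepare r F => dpush (fun q => Ready r F q : @pos R T P Q) (prepareE (st r F))
  | Recover (Some x) => dpush (@to_settle _ _ _ _ f0)
      (joint f0 (res_kernel QQ x.1) (recoverW (st x.1 x.2)))
  | Recover None => dpush (@to_settle _ _ _ _ f0) (joint f0 Lam W0) end.
apply: (@recover_outcome _ _ _ _ _ _ TT PP QQ f0 test Qtrans Qenables plN plJ
  (fun r F => syncW (st r F)) (fun r F => syncT (st r F)) D0 _ _ (Recover None) th Lam E o _ Ho).
- move=> r F /Hst[[G1 [E1 [HN iE fB HW Bs]]] _].
  exists (settleB (st r F)), G1, E1, (settleW (st r F)); split => //.
  split => //; first by case: iE.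
    by rewrite push_push -(joint_push HW fB).
  by move=> x /supp_push[y _ <-].
- move=> r F rF npr; have [_ /(_ npr)[HN iE Hr]] := Hst r F rF.
  exists (prepareE (st r F)); split => //.
    split => //; first by case: iE.
      apply: sd_eqEx => f f_ge0; rewrite !Ex_push Ex_prod Ex_point//; exact: Ex_ge0.
    by move=> x /supp_push[y _ <-].
  case rB : (kG r) Hr => [B|//]; case: ifP => // _ [a [E1 [G1 [E2 [tT HWa HN' i2 [fB HW]]]]]].
  exists a, E1; split => //; exists G1, E2, (recoverW (st r F)); split => //.
    split => //; first by case: i2.
      by rewrite /plJ /= /res_kernel rB push_push -(joint_push HW fB).
    by move=> x /supp_push[y _ <-].
  by rewrite /plJ /= /res_kernel rB.
exists G, E', W0; split => //; split => //.
  by rewrite push_push -(joint_push HW0 fLam).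
by move=> x /supp_push[y _ <-].
Qed.

End Strategy.

Theorem theorem28 (R : realType) (Act : Type) (Omega : choiceType)
    (P T : choiceType) (PP : plts R P Act) (TT : plts R T (Act + Omega)%type)
    (D G : subdist R P) :
  countable [set: Omega]%classic -> infinite_set [set: Omega]%classic ->
  test_conditions TT ->
  full D -> full G ->
  finitary PP D -> finitary PP G ->
  convergent PP D -> convergent PP G ->
  fs_le PP D G -> rrmust_le TT PP D G.
Proof.
move=> _ _ test fD _ finD _ convD _ [Dn DDn GDn] th h _ _.
have iD : reachable_full PP D D by split => // s; exact: reachable_base.
have [N HN] := wtau_derivation DDn.
have iDn := derivation_reachable_full finD convD HN iD.
have [W HW] := simulated_coupling GDn iDn.
(* It suffices that the rewards on the side of [G] are among those on the side of [D]; the same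
   outcome [out] serves as witness. *)
apply: ereal_inf_le_tmp => _ [out [Q [QQ [Lam [f0 [V [res HV ->]]]]]] <-].
have [det fLam Qtrans Qenables] := res.
exists (fun w => expect Lam (V ^~ w)) => //.
apply: (simulation_outcome test det Qtrans Qenables finD convD fLam HN _ HW).
  by case: iDn.
by move=> w; exact: expect_value HV.
Qed.
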